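(* Let $X$ be a real random variable with a density and characteristic function $f(t)=\mathbb{E}\,e^{itX}$, $t\in\mathbb{R}$. Let $Z_n=\frac{1}{\sqrt n}(X+X_1+\dots+X_n)$, where $(X_n)_{n\ge1}$ are independent Bernoulli random variables taking the values $\pm1$ with probability $1/2$ each, independent of $X$. Assume that $f(\pi k)=0$ for all $k\in\mathbb{Z}$, $k\ne0$. If $\mathbb{E}|X|<\infty$ and $f'$ is integrable on $\mathbb{R}$, then the random variables $Z_n$ have continuous densities $p_n$ such that $$\sup_{x\in\mathbb{R}}|p_n(x)-\varphi(x)|\to0\quad\text{as } n\to\infty.$$
   Context: $\varphi(x)=\frac{1}{\sqrt{2\pi}}e^{-x^2/2}$ is the standard normal density on $\mathbb{R}$. *)

(* Defs.v *)
From mathcomp Require Import all_boot all_order all_algebra.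
From mathcomp Require Import all_classical all_reals all_analysis.
From mathcomp Require Import complex.

Set Implicit Arguments.
Unset Strict Implicit.
Unset Printing Implicit Defensive.

Import Order.TTheory GRing.Theory Num.Theory.
Import numFieldNormedType.Exports.

Local Open Scope classical_set_scope.
Local Open Scope ring_scope.

Section complex_valued.
Variable R : realType.

Definition expi (x : R) : R[i] := Complex (cos x) (sin x).

(* Derivatives and integrability of functions R -> R[i] are taken
   componentwise. *)
Definition cderive1 (f : R -> R[i]) (t : R) : R[i] :=
  Complex (derive1 (fun s => complex.Re (f s)) t)
          (derive1 (fun s => complex.Im (f s)) t).

Definition cintegrable (f : R -> R[i]) : Prop :=
  (@lebesgue_measure R).-integrable setT (fun t => (complex.Re (f t))%:E) /\
  (@lebesgue_measure R).-integrable setT (fun t => (complex.Im (f t))%:E).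

End complex_valued.

Section random_variables.
Context d (T : measurableType d) (R : realType) (P : probability T R).

Definition cexpectation (Y : T -> R[i]) : R[i] :=
  Complex (fine 'E_P[fun w => complex.Re (Y w)]%E)
          (fine 'E_P[fun w => complex.Im (Y w)]%E).

Definition charfun (X : T -> R) (t : R) : R[i] :=
  cexpectation (fun w => expi (t * X w)).

Definition is_density (X : T -> R) (p : R -> R) : Prop :=
  [/\ measurable_fun setT p,
      forall x, 0 <= p x
    & forall A : set R, measurable A ->
        P (X @^-1` A) = (\int[@lebesgue_measure R]_(x in A) (p x)%:E)%E].

Definition mutually_independent (I : eqType) (X : I -> {RV P >-> R}) : Prop :=
  forall (J : seq I) (A : I -> set R), uniq J ->
    (forall i, i \in J -> measurable (A i)) ->
    P (\big[setI/setT]_(i <- J) (X i @^-1` A i)) =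
    (\prod_(i <- J) P (X i @^-1` A i))%E.

Definition sym_bernoulli (X : T -> R) : Prop :=
  P (X @^-1` [set 1]) = (2^-1)%:E /\ P (X @^-1` [set -1]) = (2^-1)%:E.

(* X followed by the sequence X_1, X_2, ...; the value Xs 0 is not used. *)
Definition with_initial (X : {RV P >-> R}) (Xs : nat -> {RV P >-> R}) (n : nat)
    : {RV P >-> R} :=
  if n is 0%N then X else Xs n.

Definition normalized_sum (X : T -> R) (Xs : nat -> T -> R) (n : nat) (w : T)
    : R :=
  (X w + \sum_(1 <= k < n.+1) Xs k w) / Num.sqrt n%:R.

End random_variables.

Definition std_normal_pdf (R : realType) : R -> R := normal_pdf 0 1.

(* Main.v *)
(* By Fourier inversion the density of [Z_n] is [x |-> (2 pi)^-1 int e^(-isx)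
   f(s / sqrt n) cos(s / sqrt n)^n ds], so its uniform distance to the normal
   density is at most [(2 pi)^-1 int |f(s / sqrt n) cos(s / sqrt n)^n -
   e^(-s^2/2)| ds].  On [|s| <= pi sqrt n / 2] this tends to 0 by dominated
   convergence, as [0 <= cos t <= e^(-t^2/2)] for [|t| <= pi / 2].  The rest of
   the line, in the variable [t = s / sqrt n], is cut into cells of length [pi]
   centred at the points [pi k], [k <> 0].  Since [f (pi k) = 0], on the [k]-th
   cell [|f|] is at most the integral [m_k] of [|f'|] over that cell.  This makes
   [f] integrable (which justifies the inversion), and the [k]-th cell contributes
   at most [sqrt (2 pi) m_k], a summable bound independent of [n]; moreover each
   contribution vanishes in the limit because [f] is continuous and vanishes at
   the centre, so dominated convergence applies to the sum over [k].
   Complex-valued functions are handled through their real and imaginary parts. *)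

From HB Require Import structures.
Require Import Defs.
From mathcomp Require Import all_boot all_order all_algebra.
From mathcomp Require Import all_classical all_reals all_analysis.
From mathcomp Require Import measurable_realfun complex ring lra.
Set Implicit Arguments.
Unset Strict Implicit.
Unset Printing Implicit Defensive.
Import Order.TTheory GRing.Theory Num.Theory.
Import numFieldNormedType.Exports.
Local Open Scope classical_set_scope.
Local Open Scope ring_scope.

(** * Affine changes of variables *)

(** Inversion is proved for [X] alone. The densities of the sums then come from the recursion
    p_(n+1)(x) = (p_n(x - 1) + p_n(x + 1)) / 2, which under the Fourier integral is multiplication
    by cos t. Inversion itself goes through [X] plus a small independent Gaussian noise: the density
    of this sum has an absolutely convergent Fourier formula; as the noise shrinks, it stays bounded
    and tends to the inverse Fourier integral, while its integral over an interval tends to the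
    probability of that interval, provided the endpoints are not atoms. This is where the density of
    [X] enters. The constant sqrt (2 pi) in the cell bound is the integral of e^(-s^2/2): |cos| has
    period pi, so every cell can be translated onto the central one, where the Gaussian domination
    holds for all n. One statement on real functions h serves for both components of f: its limit is
    the Gaussian multiplied by h(0), which is 1 for the real part and 0 for the imaginary part. *)

Section affine.
Context {R : realType}.
Notation mu := (@lebesgue_measure R).
Local Open Scope ereal_scope.
Implicit Types (b c : R).

Lemma measurable_affine c b :
  measurable_fun [set: R] (fun x : R => (c * x + b)%R).
Proof. by apply: measurable_funD => //; exact: measurable_funM. Qed.

(** By uniqueness of Lebesgue measure: the pushforward scaled by [c] gives every half-open interval
    its length. *)
Lemma lebesgue_measure_affine c b (A : set R) : (0 < c)%R -> measurable A ->
  mu A = c%:E * mu ((fun x => c * x + b)%R @^-1` A).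
Proof.
move=> c0 mA; pose k : {nonneg R} := NngNum (ltW c0).
apply: (@lebesgue_measure_unique _ (mscale k (pushforward mu
  ((fun x => c * x + b)%R : _ -> measurableTypeR R)))) => //=.
  exact: measurable_affine.
move=> ? _ [[x y]] _ <-; rewrite /mscale/= /pushforward/=.
have -> : (fun x => c * x + b)%R @^-1` `]x, y] =
    `]((x - b) / c)%R, ((y - b) / c)%R]%classic.
  apply/seteqP; split=> z /=; rewrite !in_itv/=.
  - by rewrite ltr_pdivrMr// ler_pdivlMr// ltrBlDr lerBrDr (mulrC z).
  - by rewrite ltr_pdivrMr// ler_pdivlMr// ltrBlDr lerBrDr (mulrC z).
rewrite !lebesgue_measure_itv/= !lte_fin ltr_pM2r ?invr_gt0// ltrD2r.
case: ifPn => _; last by rewrite mule0.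
by rewrite -!EFinD -EFinM; congr EFin; field; rewrite gt_eqF.
Qed.

Lemma ge0_integral_affine c b (f : R -> \bar R) : (0 < c)%R ->
  measurable_fun [set: R] f -> (forall x, 0 <= f x) ->
  \int[mu]_x f x = c%:E * \int[mu]_x f (c * x + b)%R.
Proof.
move=> c0 mf f0; pose k : {nonneg R} := NngNum (ltW c0).
rewrite -(@ge0_integral_pushforward _ _ (measurableTypeR R) (measurableTypeR R) _ _
  (measurable_affine c b) mu setT f)//.
rewrite -[c%:E]/(k%:num%:E) -ge0_integral_mscale//.
  exact: measurable_affine.
move=> ?; apply: eq_measure_integral => A mA _.
exact: lebesgue_measure_affine.
Qed.

Lemma ge0_integral_opp (f : R -> \bar R) :
  measurable_fun [set: R] f -> (forall x, 0 <= f x) ->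
  \int[mu]_x f x = \int[mu]_x f (- x)%R.
Proof.
move=> mf f0.
rewrite -(@ge0_integral_pushforward _ _ (measurableTypeR R) (measurableTypeR R) _ _
  (@oppr_measurable R [set: R]) mu setT f)//.
by apply: eq_measure_integral => A mA _; exact/esym/lebesgue_measureN.
Qed.

Lemma integrable_affine c b (f : R -> \bar R) : (0 < c)%R ->
  mu.-integrable [set: R] f ->
  mu.-integrable [set: R] (fun x => f (c * x + b)%R).
Proof.
move=> c0 /integrableP[mf foo]; apply/integrableP; split.
  by apply: (measurableT_comp mf); exact: measurable_affine.
move: foo; rewrite (@ge0_integral_affine c b)//; last exact: measurableT_comp.
rewrite muleC -lte_pdivlMr// => /lt_le_trans; apply; exact: leey.
Qed.

Lemma Rintegral_affine c b (f : R -> R) : (0 < c)%R ->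
  mu.-integrable [set: R] (EFin \o f) ->
  (\int[mu]_x f x = c * \int[mu]_x f (c * x + b))%R.
Proof.
move=> c0 fi; have /measurable_int mf := fi.
have fi' : mu.-integrable [set: R] (fun x => (f (c * x + b)%R)%:E).
  exact: (@integrable_affine c b (EFin \o f)).
rewrite /Rintegral [in LHS]integralE [in RHS]integralE.
rewrite (@ge0_integral_affine c b (EFin \o f)^\+)//; last exact: measurable_funepos.
rewrite (@ge0_integral_affine c b (EFin \o f)^\-)//; last exact: measurable_funeneg.
pose I1 := \int[mu]_x (EFin \o f)^\+ (c * x + b)%R.
pose I2 := \int[mu]_x (EFin \o f)^\- (c * x + b)%R.
have fin1 : I1 \is a fin_num.
  by apply: integrable_fin_num => //; apply: integrable_affine => //; exact: integrable_funepos.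
have fin2 : I2 \is a fin_num.
  by apply: integrable_fin_num => //; apply: integrable_affine => //; exact: integrable_funeneg.
rewrite -/I1 -/I2.
have -> : \int[mu]_x (fun x0 => (f (c * x0 + b))%:E)^\+ x = I1 by apply: eq_integral => x _; rewrite !funeposE.
have -> : \int[mu]_x (fun x0 => (f (c * x0 + b))%:E)^\- x = I2 by apply: eq_integral => x _; rewrite !funenegE.
by rewrite -(fineK fin1) -(fineK fin2) -!EFinM -!EFinB/= mulrBr.
Qed.

End affine.

(** * Powers of the cosine and the Gaussian *)

Section cos_gauss.
Context {R : realType}.
Implicit Types t x s : R.

(** The elementary inequalities below all follow this way: the difference of the two sides, possibly
    after multiplication by a positive factor, vanishes at 0 and has a nonnegative derivative. *)
Lemma le_of_derive_ge0 (f df : R -> R) t : 0 <= t ->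
  (forall x, is_derive x 1 f (df x)) ->
  (forall x, 0 < x < t -> 0 <= df x) -> f 0 <= f t.
Proof.
move=> t0 fd df0.
have drv x : derivable f x 1 by have [] := fd x.
apply: (@ger0_derive1_ndecr _ f 0 t) => // [x|].
  by rewrite in_itv/= => xt; rewrite derive1E (@derive_val _ _ _ _ _ _ _ (fd x)) df0.
by apply: continuous_subspaceT => x; apply/differentiable_continuous/derivable1_diffP.
Qed.

Lemma sin_le_id t : 0 <= t -> sin t <= t.
Proof.
move=> t0; rewrite -subr_ge0.
have := @le_of_derive_ge0 (fun x => x - sin x) (fun x => 1 - cos x) t t0.
rewrite sin0 subrr; apply => x.
by rewrite subr_ge0 cos_le1.
Qed.

Lemma cos_ge_1Bsqr t : 1 - t ^+ 2 / 2 <= cos t.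
Proof.
rewrite -cos_norm -[in leLHS]real_normK ?num_real//.
move: `|t| (normr_ge0 t) => {}t t0.
rewrite -subr_ge0.
have := @le_of_derive_ge0 (fun x => cos x - (1 - x ^+ 2 / 2)) (fun x => x - sin x) t t0.
rewrite cos0 expr0n/= mul0r subr0 subrr; apply => x.
  by apply: is_derive_eq; rewrite /GRing.scale/=; field.
by move=> /andP[/ltW x0 _]; rewrite subr_ge0 sin_le_id.
Qed.

Lemma mul_cos_le_sin t : 0 <= t <= pi -> t * cos t <= sin t.
Proof.
move=> /andP[t0 tpi]; rewrite -subr_ge0.
have := @le_of_derive_ge0 (fun x => sin x - x * cos x) (fun x => x * sin x) t t0.
rewrite sin0 mul0r subrr; apply => x.
  by apply: is_derive_eq; rewrite /GRing.scale/=; ring.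
by move=> /andP[/ltW x0 xt]; rewrite mulr_ge0// sin_ge0_pi// x0 (le_trans (ltW xt)).
Qed.

Lemma cos_le_expR t : `|t| <= pi / 2 -> cos t <= expR (- (t ^+ 2 / 2)).
Proof.
rewrite -cos_norm -[t ^+ 2]real_normK ?num_real//.
move: `|t| (normr_ge0 t) => {}t t0 tpi.
rewrite expRN -[leRHS]div1r ler_pdivlMr ?expR_gt0// -subr_ge0.
(* After multiplication by e^(x^2/2), the sign of the derivative is that of sin x - x cos x. *)
have := @le_of_derive_ge0 (fun x => 1 - cos x * expR (x ^+ 2 / 2))
  (fun x => (sin x - x * cos x) * expR (x ^+ 2 / 2)) t t0.
rewrite cos0 expr0n/= mul0r expR0 mul1r subrr; apply => x.
  apply: is_derive_eq; rewrite /GRing.scale/=; field.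
  by [].
move=> /andP[/ltW x0 /ltW xt]; rewrite mulr_ge0 ?expR_ge0// subr_ge0 mul_cos_le_sin//.
have := @pi_ge0 R; lra.
Qed.

(** Since e^y >= 1 + y, it is enough that (1 - x)(1 + x + 2x^2) = 1 + x^2 (1 - 2x) >= 1, which is
    where x <= 1/2 is used. *)
Lemma expR_le_1B x : 0 <= x <= 1 / 2 -> expR (- (x + 2 * x ^+ 2)) <= 1 - x.
Proof.
move=> /andP[x0 x1]; rewrite expRN -[leLHS]div1r ler_pdivrMr ?expR_gt0//.
have := expR_ge1Dx (x + 2 * x ^+ 2).
rewrite -subr_ge0 => h.
nra.
Qed.

End cos_gauss.

(** * Gaussian domination and the Laplace method on the central window *)

Section laplace.
Context {R : realType}.
Notation mu := (@lebesgue_measure R).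
Implicit Types (s t x : R) (n : nat).

Definition gauss x : R := expR (- (x ^+ 2 / 2)).

Lemma gauss_ge0 x : 0 <= gauss x. Proof. exact: expR_ge0. Qed.

#[global] Instance is_derive_gauss x : is_derive x 1 gauss (- (x * gauss x)).
Proof.
by rewrite /gauss; apply: is_derive_eq; rewrite /GRing.scale/=; field.
Qed.

Lemma continuous_gauss : continuous gauss.
Proof. by move=> x; apply/differentiable_continuous/derivable1_diffP. Qed.

Lemma measurable_gauss : measurable_fun setT gauss.
Proof. apply: continuous_measurable_fun; exact: continuous_gauss. Qed.

Lemma normal_pdfE_gauss (e x : R) : 0 < e ->
  normal_pdf 0 e x = (Num.sqrt (2 * pi) * e)^-1 * gauss (x / e).
Proof.
move=> e0; rewrite normal_pdfE ?gt_eqF// /normal_peak /normal_fun /gauss.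
rewrite subr0 -mulrnAr sqrtrM ?sqr_ge0// sqrtr_sqr gtr0_norm// mulr_natl (mulrC e).
congr (_ * expR _).
by rewrite -(mulr_natr (e ^+ 2)); field; rewrite gt_eqF.
Qed.

Lemma sqrt2pi_gt0 : 0 < Num.sqrt (2 * pi) :> R.
Proof. by rewrite sqrtr_gt0 mulr_gt0// pi_gt0. Qed.

Lemma gaussE x : gauss x = Num.sqrt (2 * pi) * normal_pdf 0 1 x.
Proof.
by rewrite normal_pdfE_gauss// mulr1 divr1 mulrA divff ?mul1r// gt_eqF// sqrt2pi_gt0.
Qed.

Lemma integrable_gauss : mu.-integrable setT (EFin \o gauss).
Proof.
rewrite (_ : _ \o _ = fun x => (Num.sqrt (2 * pi))%:E * (normal_pdf 0 1 x)%:E)%E; last first.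
  by apply/funext => x /=; rewrite gaussE EFinM.
by apply: integrableZl => //; exact: integrable_normal_pdf.
Qed.

Lemma integral_gauss : (\int[mu]_x (gauss x)%:E = (Num.sqrt (2 * pi))%:E)%E.
Proof.
under eq_integral do rewrite gaussE EFinM.
rewrite integralZl//; last exact: integrable_normal_pdf.
by rewrite integral_normal_pdf mule1.
Qed.

Lemma cos_pow_bounds n s : `|s| <= pi / 2 * Num.sqrt n%:R ->
  0 <= cos (s / Num.sqrt n%:R) ^+ n <= gauss s.
Proof.
have [->|n0] := posnP n.
  (* For n = 0 the window shrinks to the origin, where both the empty power and the Gaussian equal
     1. *)
  rewrite sqrtr0 mulr0 normr_le0 => /eqP ->.
  by rewrite expr0 ler01 /gauss expr0n/= mul0r oppr0 expR0 lexx.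
move=> sn.
have n0' : 0 < Num.sqrt n%:R :> R by rewrite sqrtr_gt0 ltr0n.
have {}sn : `|s / Num.sqrt n%:R| <= pi / 2.
  by rewrite normrM normfV (gtr0_norm n0') ler_pdivrMr.
have c0 : 0 <= cos (s / Num.sqrt n%:R).
  by apply: cos_ge0_pihalf; rewrite -ler_norml.
rewrite exprn_ge0//=.
have -> : gauss s = expR (- ((s / Num.sqrt n%:R) ^+ 2 / 2)) ^+ n.
  rewrite -expRM_natl exprMn exprVn sqr_sqrtr// /gauss; congr expR.
  by field; rewrite pnatr_eq0 -lt0n.
by rewrite lerXn2r ?nnegrE ?expR_ge0// cos_le_expR.
Qed.

Lemma near_sqrtn (c : R) : \forall n \near \oo, c <= Num.sqrt n%:R.
Proof.
near=> n.
have : c ^+ 2 <= n%:R.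
  by near: n; exact: nbhs_infty_ger.
move=> h; apply: (le_trans (ler_norm c)).
by rewrite -(ler_pXn2r (n := 2)) ?nnegrE// sqr_sqrtr// real_normK// num_real.
Unshelve. all: by end_near. Qed.

Lemma cvg_div_sqrtn s : s / Num.sqrt n%:R @[n --> \oo] --> 0.
Proof.
rewrite -(mulr0 s); apply: cvgM; first exact: cvg_cst.
apply/gtr0_cvgV0; last by apply/cvgryPge => c; exact: near_sqrtn.
by near=> n; rewrite sqrtr_gt0 ltr0n; near: n; exact: nbhs_infty_gt.
Unshelve. all: by end_near. Qed.

(** The upper bound is the Gaussian itself. For the lower one, put x = s^2 / (2n): cos (s / sqrt n)
    >= 1 - x >= e^(-(x + 2x^2)), and n (x + 2x^2) = s^2/2 + s^4/(2n). *)
Lemma cos_pow_cvg s :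
  cos (s / Num.sqrt n%:R) ^+ n @[n --> \oo] --> gauss s.
Proof.
apply: (@squeeze_cvgr _ _ _ _ (fun n => expR (- (s ^+ 2 / 2 + (s ^+ 4 / 2) * n%:R^-1))) (fun=> gauss s)).
- near=> n.
  have n0 : (0 < n)%N by near: n; exact: nbhs_infty_gt.
  have n0' : 0 < n%:R :> R by rewrite ltr0n.
  have sn : `|s| <= Num.sqrt n%:R by near: n; exact: near_sqrtn.
  have sn' : s ^+ 2 <= n%:R.
    rewrite -[n%:R]sqr_sqrtr// -[s ^+ 2]real_normK ?num_real//.
    by rewrite lerXn2r ?nnegrE ?sqrtr_ge0.
  have /andP[_ ->] : 0 <= cos (s / Num.sqrt n%:R) ^+ n <= gauss s.
    apply: cos_pow_bounds; apply: (le_trans sn).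
    by rewrite ler_peMl ?sqrtr_ge0// pihalf_ge1.
  rewrite andbT; pose x := s ^+ 2 / n%:R / 2.
  have xb : 0 <= x <= 1 / 2.
    rewrite /x !divr_ge0 ?sqr_ge0//= ler_pM2r// ler_pdivrMr// mul1r//.
  have -> : - (s ^+ 2 / 2 + s ^+ 4 / 2 / n%:R) = n%:R * (- (x + 2 * x ^+ 2)).
    by rewrite /x; field; rewrite gt_eqF.
  rewrite expRM_natl; have xc : 1 - x <= cos (s / Num.sqrt n%:R).
    have := cos_ge_1Bsqr (s / Num.sqrt n%:R).
    by rewrite exprMn exprVn sqr_sqrtr.
  have c1 := le_trans (expR_le_1B xb) xc.
  by rewrite lerXn2r ?nnegrE ?expR_ge0//; apply: le_trans c1; exact: expR_ge0.
- apply: (cvg_comp _ expR); last exact: continuous_expR.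
  have h : s ^+ 2 / 2 + s ^+ 4 / 2 / n%:R @[n --> \oo] --> s ^+ 2 / 2 + s ^+ 4 / 2 * 0.
    apply: cvgD; first exact: cvg_cst.
    apply: cvgM; first exact: cvg_cst.
    apply/gtr0_cvgV0; last exact: cvgr_idn.
    by near=> n; rewrite ltr0n; near: n; exact: nbhs_infty_gt.
  by apply: cvgN; rewrite mulr0 addr0 in h.
- exact: cvg_cst.
Unshelve. all: by end_near. Qed.

(** The cell around 0, seen in the variable s = t sqrt n. *)
Definition win n : set R :=
  `[- (pi / 2 * Num.sqrt n%:R), pi / 2 * Num.sqrt n%:R].

Lemma winP n s : win n s <-> `|s| <= pi / 2 * Num.sqrt n%:R.
Proof. by rewrite /win /= in_itv/= -ler_norml. Qed.

Lemma measurable_cos_pow n (c : R) : measurable_fun [set: R] (fun s => cos (s / c) ^+ n).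
Proof.
apply: measurable_funX; apply: measurableT_comp => //.
  by apply: continuous_measurable_fun; exact: continuous_cos.
exact: measurable_funM.
Qed.

(** Convergence in L^1, dominated by a multiple of the Gaussian. It is used with [G] the function
    itself for the main term, and with [G] a translate of its absolute value, vanishing at 0, for
    each of the other cells. *)
Lemma laplace_cvg (G : R -> R) (M : R) : measurable_fun setT G ->
  (forall t, `|t| <= pi / 2 -> `|G t| <= M) -> G t @[t --> 0] --> G 0 ->
  (\int[mu]_s `|\1_(win n) s * (cos (s / Num.sqrt n%:R) ^+ n * G (s / Num.sqrt n%:R))
     - gauss s * G 0|%:E @[n --> \oo] --> 0)%E.
Proof.
move=> mG GM G0.
have mf n : measurable_fun setT (fun s =>
    (\1_(win n) s * (cos (s / Num.sqrt n%:R) ^+ n * G (s / Num.sqrt n%:R)))%:E).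
  apply/measurable_EFinP; apply: measurable_funM.
    by apply: measurable_indic; exact: measurable_itv.
  apply: measurable_funM; first exact: measurable_cos_pow.
  by apply: measurableT_comp => //; exact: measurable_funM.
have [||||_ + _] := @dominated_convergence _ _ _ mu setT measurableT
  (fun n s => (\1_(win n) s * (cos (s / Num.sqrt n%:R) ^+ n * G (s / Num.sqrt n%:R)))%:E)
  (fun s => (gauss s * G 0)%:E) (fun s => (M%:E * (gauss s)%:E)%E) mf.
- by apply/measurable_EFinP; apply: measurable_funM => //; exact: measurable_gauss.
- apply: aeW => s _; apply: cvg_EFin; first exact: nearW.
  rewrite /comp/= -[X in _ --> X]mul1r.
  apply: cvgM.
    apply: cvg_near_cst; near=> n; rewrite indicE mem_set//; apply/winP.
    have sn : `|s| <= Num.sqrt n%:R by near: n; exact: near_sqrtn.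
    by rewrite (le_trans sn)// ler_peMl ?sqrtr_ge0// pihalf_ge1.
  apply: cvgM; first exact: cos_pow_cvg.
  exact: cvg_comp (cvg_div_sqrtn s) G0.
- by apply: integrableZl => //; exact: integrable_gauss.
- apply: aeW => s n _; rewrite lee_fin.
  rewrite indicE; have [/set_mem/winP sn|_] := boolP (s \in _); last first.
    (* Off the window only 0 <= [M] is at stake, and it follows from the bound on [G] at 0. *)
    by rewrite mul0r normr0 mulr_ge0 ?gauss_ge0// (le_trans (normr_ge0 (G 0)))// GM// normr0 divr_ge0// pi_ge0.
  rewrite mul1r normrM mulrC; have /andP[c0 cg] := cos_pow_bounds sn.
  rewrite (ger0_norm c0) ler_pM// GM// normrM normfV (ger0_norm (sqrtr_ge0 _)).
  (* For n = 0 the division by sqrt 0 returns 0, a point of the allowed range. *)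
  have [->|n0] := posnP n; first by rewrite sqrtr0 invr0 mulr0 divr_ge0// pi_ge0.
  by rewrite ler_pdivrMr// sqrtr_gt0 ltr0n.
by under eq_fun do under eq_integral do rewrite -EFinB/=.
Unshelve. all: by end_near. Qed.

End laplace.

(** * Functions vanishing at the multiples of pi *)

Section blocks.
Context {R : realType}.
Notation mu := (@lebesgue_measure R).
Local Open Scope ereal_scope.

(** The integral runs over a larger set [A] so that one bound serves for all pairs of points of a
    cell, or of the whole line. *)
Lemma FTC_norm_le (h : R -> R) (A : set R) (a b : R) : (a <= b)%R ->
  (forall x, derivable h x 1) -> continuous (derive1 h) ->
  measurable A -> `[a, b] `<=` A ->
  `|(h b - h a)%:E| <= \int[mu]_(x in A) `|(derive1 h x)%:E|.
Proof.
move=> ab dh ch mA abA.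
have mh' : measurable_fun setT (derive1 h) by apply: continuous_measurable_fun.
have [->|/eqP anb] := eqVneq a b; first by rewrite subrr abse0 integral_ge0.
have {anb}ab : (a < b)%R by rewrite lt_neqAle ab andbT; apply/eqP.
rewrite EFinB -(@continuous_FTC2 _ (derive1 h) h a b ab).
- apply: le_trans (le_abse_integral _ _ _) _ => //.
    by apply/measurable_EFinP; exact: measurable_funTS.
  apply: ge0_subset_integral => //.
  by apply: measurableT_comp => //; apply/measurable_EFinP; exact: measurable_funTS.
- exact: continuous_subspaceT.
- have cc : continuous h by move=> x; apply/differentiable_continuous/derivable1_diffP.
  split; first by move=> x _; exact: dh.
    by apply: cvg_at_right_filter; exact: cc.
  by apply: cvg_at_left_filter; exact: cc.
- by [].
Qed.

(** Supplies the constant bound that [laplace_cvg] asks for. *)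
Lemma norm_le_integral_derive1 (h : R -> R) (c : R) :
  (forall x, derivable h x 1) -> continuous (derive1 h) ->
  mu.-integrable setT (EFin \o derive1 h) -> h c = 0%R ->
  forall t, (`|h t| <= fine (\int[mu]_x `|(derive1 h x)%:E|))%R.
Proof.
move=> dh ch /integrableP[_ foo] hc t.
rewrite -lee_fin fineK ?ge0_fin_numE ?integral_ge0//.
have [tc|/ltW ct] := leP t c.
  have := @FTC_norm_le h setT t _ tc dh ch measurableT (@subsetT _ _).
  by rewrite hc sub0r EFinN abseN.
have := @FTC_norm_le h setT _ t ct dh ch measurableT (@subsetT _ _).
by rewrite hc subr0.
Qed.

(* The cell centred at [pi * (k + 1)]. *)
Definition blk (k : nat) : set R :=
  `[(pi / 2 + pi * k%:R)%R, (pi / 2 + pi * k.+1%:R)%R[%classic.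

Lemma measurable_blk k : measurable (blk k).
Proof. exact: measurable_itv. Qed.

Lemma trivIset_blk : trivIset setT blk.
Proof.
apply: ltn_trivIset => // m n mn; rewrite /blk.
apply/seteqP; split=> // x [/=]; rewrite !in_itv/= => /andP[_ x1] /andP[x2 _].
have := le_lt_trans x2 x1.
by rewrite ltrD2l ltr_pM2l ?pi_gt0// ltr_nat ltnS leqNgt mn.
Qed.

Lemma bigcup_blk : \bigcup_k blk k = `[(pi / 2)%R, +oo[%classic.
Proof.
apply/seteqP; split=> x /=; rewrite in_itv/= andbT.
  move=> [k _]; rewrite /blk/= in_itv/= => /andP[+ _]; apply: le_trans.
  by rewrite lerDl mulr_ge0// pi_ge0.
move=> px; have p0 := @pi_gt0 R.
have y0 : (0 <= (x - pi / 2) / pi)%R by rewrite divr_ge0 ?subr_ge0// ltW.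
have /andP[k1 k2] := truncn_itv y0.
exists (Num.truncn ((x - pi / 2) / pi)) => //; rewrite /blk/= in_itv/=.
move: k1 k2; rewrite ler_pdivlMr// ltr_pdivrMr// => k1 k2.
by apply/andP; split; lra.
Qed.

Lemma integral_indicM (A : set R) (f : R -> R) :
  \int[mu]_(x in A) (f x)%:E = \int[mu]_x (\1_A x * f x)%:E.
Proof.
rewrite integral_mkcond; apply: eq_integral => x _.
by rewrite patchE indicE; case: ifP => _; rewrite ?mul1r ?mul0r.
Qed.

Lemma cosDpin (x : R) k : `|cos (x + pi * k%:R)|%R = `|cos x|%R.
Proof.
elim: k => [|k IH]; first by rewrite mulr0 addr0.
by rewrite -natr1 mulrDr mulr1 addrA cosDpi normrN.
Qed.

(** Substituting t = s / sqrt n + pi (k + 1) leaves |cos| unchanged and carries the cell into the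
    central window, where cos is nonnegative. Only an inequality results, since the cell is
    half-open and the window closed. *)
Lemma integral_blk_cos (G : R -> R) n k : (0 < n)%N -> measurable_fun setT G ->
  (forall t, 0 <= G t)%R ->
  (Num.sqrt n%:R)%:E * \int[mu]_(t in blk k) (`|cos t| ^+ n * G t)%:E <=
  \int[mu]_s (\1_(win n) s * (cos (s / Num.sqrt n%:R) ^+ n *
    G (s / Num.sqrt n%:R + pi * k.+1%:R)))%:E.
Proof.
move=> n0 mG G0; rewrite integral_indicM.
have n0' : (0 < Num.sqrt n%:R :> R)%R by rewrite sqrtr_gt0 ltr0n.
have mcos : measurable_fun [set: R] (fun t => `|cos t| ^+ n)%R.
  apply: measurable_funX; apply: measurableT_comp => //.
  by apply: continuous_measurable_fun; exact: continuous_cos.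
rewrite (@ge0_integral_affine _ (Num.sqrt n%:R)^-1 (pi * k.+1%:R)) ?invr_gt0//; first last.
- by move=> x; rewrite lee_fin mulr_ge0// mulr_ge0// exprn_ge0.
- apply/measurable_EFinP/measurable_funM; last exact: measurable_funM.
  by apply: measurable_indic; exact: measurable_blk.
rewrite muleA -EFinM divff ?gt_eqF// mul1e.
have mG' : measurable_fun [set: R] (fun s => G (s / Num.sqrt n%:R + pi * k.+1%:R))%R.
  apply: measurableT_comp => //; apply: measurable_funD => //.
  exact: measurable_funM.
apply: ge0_le_integral => //.
- by move=> x _; rewrite lee_fin mulr_ge0// mulr_ge0// exprn_ge0.
- apply/measurable_EFinP; apply: (@measurableT_comp _ _ _ _ _ _
    (fun t => \1_(blk k) t * (`|cos t| ^+ n * G t))%R).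
    apply: measurable_funM; last exact: measurable_funM.
    by apply: measurable_indic; exact: measurable_blk.
  exact: measurable_affine.
- apply/measurable_EFinP/measurable_funM.
    by apply: measurable_indic; exact: measurable_itv.
  by apply: measurable_funM => //; exact: measurable_cos_pow.
- move=> s _; rewrite lee_fin mulrC.
  rewrite cosDpin (mulrC _ s) [leRHS]mulrC !indicE.
  have [/set_mem sb|_] := boolP (_ \in blk k); last first.
    rewrite mulr0; have [/set_mem/winP/cos_pow_bounds/andP[c0 _]|_] := boolP (_ \in _).
      by rewrite mulr1 mulr_ge0.
    by rewrite mulr0.
  have sw : (`|s| <= pi / 2 * Num.sqrt n%:R)%R.
    move: sb; rewrite /blk/= in_itv/= -(natr1 k) => /andP[s1 s2].
    rewrite -ler_pdivrMr// -(gtr0_norm n0') -normf_div ler_norml.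
    by apply/andP; split; lra.
  rewrite mem_set; last exact/winP.
  rewrite !mulr1 ler_wpM2r// ger0_norm//.
  apply: cos_ge0_pihalf; rewrite -ler_norml normf_div (gtr0_norm n0').
  by rewrite ler_pdivrMr.
Qed.

(** * Estimates on a half-line, cell by cell *)

Section tail.
Variable h : R -> R.
Hypotheses (dh : forall x, derivable h x 1) (ch : continuous (derive1 h))
  (h0 : forall k : nat, h (pi * k.+1%:R)%R = 0%R).

Let mh' : measurable_fun setT (derive1 h).
Proof. exact: continuous_measurable_fun. Qed.

Let ch0 : continuous h.
Proof. by move=> x; apply/differentiable_continuous/derivable1_diffP. Qed.

Let mh : measurable_fun setT h.
Proof. exact: continuous_measurable_fun. Qed.

Let m k := \int[mu]_(x in blk k) `|(derive1 h x)%:E|.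

Lemma le_blk k t : blk k t -> `|(h t)%:E| <= m k.
Proof.
move=> kt; have kc : blk k (pi * k.+1%:R)%R.
  rewrite /blk/= in_itv/= -(natr1 k).
  by have := @pi_gt0 R => p0; apply/andP; split; lra.
have [tc|/ltW ct] := leP t (pi * k.+1%:R)%R.
- have := @FTC_norm_le h (blk k) t _ tc dh ch (measurable_blk k).
  rewrite h0 sub0r EFinN abseN; apply.
  move: kt kc; rewrite /blk/= => kt kc x /=; rewrite !in_itv/= => /andP[tx xc].
  move: kt kc; rewrite !in_itv/= => /andP[k1 k2] /andP[k3 k4].
  by rewrite (le_trans k1 tx) (le_lt_trans xc k4).
- have := @FTC_norm_le h (blk k) _ t ct dh ch (measurable_blk k).
  rewrite h0 subr0; apply.
  move: kt kc; rewrite /blk/= => kt kc x /=; rewrite !in_itv/= => /andP[tx xc].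
  move: kt kc; rewrite !in_itv/= => /andP[k1 k2] /andP[k3 k4].
  by rewrite (le_trans k3 tx) (le_lt_trans xc k2).
Qed.

(** Applied with the weight 1 and C = pi, the length of a cell, to get integrability, and with the
    weight sqrt n |cos t|^n and C = sqrt (2 pi) to get a bound uniform in n. *)
Lemma integral_blk_le (w : R -> R) (C : \bar R) k : measurable_fun setT w ->
  (forall t, 0 <= w t)%R -> \int[mu]_(t in blk k) (w t)%:E <= C ->
  \int[mu]_(t in blk k) (w t * `|h t|)%:E <= C * m k.
Proof.
move=> mw w0 wC.
apply: (@le_trans _ _ (\int[mu]_(t in blk k) ((w t)%:E * m k))).
  apply: ge0_le_integral => //.
  - exact: measurable_blk.
  - by move=> t _; rewrite lee_fin mulr_ge0.
  - apply/measurable_funTS/measurable_EFinP/measurable_funM => //.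
    exact: measurableT_comp.
  - apply/measurable_funTS; apply: emeasurable_funM => //.
    exact/measurable_EFinP.
  - move=> t kt; rewrite EFinM lee_wpmul2l ?lee_fin//.
    exact: le_blk.
rewrite ge0_integralZr//; last 4 first.
  exact: measurable_blk.
  by apply/measurable_funTS/measurable_EFinP.
  by move=> t _; rewrite lee_fin.
  exact: integral_ge0.
by apply: lee_wpmul2r => //; exact: integral_ge0.
Qed.

Lemma integral_tail (f : R -> R) : measurable_fun setT f ->
  (forall t, 0 <= f t)%R ->
  \int[mu]_(t in `[(pi / 2)%R, +oo[) (f t)%:E =
  \sum_(k <oo) \int[mu]_(t in blk k) (f t)%:E.
Proof.
move=> mf f0; rewrite -bigcup_blk ge0_integral_bigcup//.
- exact: measurable_blk.
- by apply/measurable_funTS/measurable_EFinP.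
- by move=> x _; rewrite lee_fin.
- exact: trivIset_blk.
Qed.

Lemma sum_m : \sum_(k <oo) m k =
  \int[mu]_(x in `[(pi / 2)%R, +oo[) `|(derive1 h x)%:E|.
Proof.
rewrite -(@integral_tail (fun x => `|derive1 h x|)%R)//.
exact: measurableT_comp.
Qed.

Hypothesis ih' : mu.-integrable setT (EFin \o derive1 h).

Let sum_m_lty : \sum_(k <oo) m k < +oo.
Proof.
rewrite sum_m; case/integrableP: ih' => _; apply: le_lt_trans.
apply: ge0_subset_integral => //.
by apply: measurableT_comp => //; exact/measurable_EFinP.
Qed.

Let m_ge0 k : 0 <= m k. Proof. exact: integral_ge0. Qed.

Lemma integrable_tail : \int[mu]_(t in `[(pi / 2)%R, +oo[) `|(h t)%:E| < +oo.
Proof.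
have := @integral_tail (fun t => `|h t|)%R; rewrite /= => ->//; last first.
  exact: measurableT_comp.
apply: (@le_lt_trans _ _ (\sum_(k <oo) (pi%:E * m k))).
  apply: lee_nneseries => k _; first by move=> *; exact: integral_ge0.
  rewrite [leLHS](_ : _ = \int[mu]_(t in blk k) (cst 1 t * `|h t|)%:E); last first.
    by apply: eq_integral => t _; rewrite mul1r.
  apply: integral_blk_le => //.
  have -> : \int[mu]_(t in blk k) (cst 1 t)%:E = 1 * mu (blk k).
    by rewrite -integral_cst//; exact: measurable_blk.
  rewrite mul1e lebesgue_measure_itv/= lte_fin.
  case: ifPn => _; last by rewrite lee_fin pi_ge0.
  by rewrite -EFinD lee_fin -(natr1 k); lra.
rewrite nneseriesZl//.
by rewrite lte_mul_pinfty// lee_fin pi_ge0.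
Qed.

(** Contribution of one cell to the integral in the variable s = t sqrt n; the factor sqrt n is the
    Jacobian. *)
Let A n k := (Num.sqrt n%:R)%:E * \int[mu]_(t in blk k) (`|cos t| ^+ n * `|h t|)%:E.

Let mcos n : measurable_fun [set: R] (fun t => `|cos t| ^+ n)%R.
Proof.
apply: measurable_funX; apply: measurableT_comp => //.
by apply: continuous_measurable_fun; exact: continuous_cos.
Qed.

Let A_le n k : (0 < n)%N -> A n k <= (Num.sqrt (2 * pi))%:E * m k.
Proof.
move=> n0; rewrite /A -ge0_integralZl//; last 2 first.
  exact: measurable_blk.
  apply/measurable_funTS/measurable_EFinP/measurable_funM; [exact: mcos|exact: measurableT_comp].
under eq_integral do rewrite -EFinM mulrA.
apply: integral_blk_le.
- by apply: measurable_funM; [exact: measurable_cst|exact: mcos].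
- by move=> t; rewrite mulr_ge0// exprn_ge0.
under eq_integral do rewrite EFinM.
rewrite ge0_integralZl//; last 2 first.
  exact: measurable_blk.
  by apply/measurable_funTS/measurable_EFinP; exact: mcos.
rewrite [in leLHS](_ : \int[mu]_(t in blk k) _ =
    \int[mu]_(t in blk k) (`|cos t| ^+ n * cst 1 t)%:E); last first.
  by apply: eq_integral => t _; rewrite mulr1.
(* Translated to the centre, the weight is dominated by the Gaussian, whose total mass is the
   constant sought. *)
apply: le_trans (@integral_blk_cos (cst 1%R) n k n0 _ (fun=> ler01)) _ => //.
rewrite -integral_gauss; apply: ge0_le_integral => //.
- move=> s _; rewrite lee_fin mulr1 indicE.
  have [/set_mem/winP/cos_pow_bounds/andP[c0 _]|_] := boolP (_ \in _); last by rewrite mul0r.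
  by rewrite mul1r.
- apply/measurable_EFinP/measurable_funM.
    by apply: measurable_indic; exact: measurable_itv.
  by apply: measurable_funM => //; exact: measurable_cos_pow.
- by apply/measurable_EFinP; exact: measurable_gauss.
- move=> s _; rewrite lee_fin mulr1 indicE.
  have [/set_mem/winP/cos_pow_bounds/andP[_ c0]|_] := boolP (_ \in _).
    by rewrite mul1r.
  by rewrite mul0r gauss_ge0.
Qed.

(** The Laplace limit on a cell is the Gaussian times the value of |h| at the centre of the cell,
    which is 0. *)
Let A_cvg k : A n k @[n --> \oo] --> 0.
Proof.
have hM := norm_le_integral_derive1 dh ch ih' (h0 0).
pose G u := (`|h (u + pi * k.+1%:R)|)%R.
have G0 : G 0%R = 0%R by rewrite /G add0r h0 normr0.
have mG : measurable_fun setT G.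
  apply: measurableT_comp => //; apply: measurableT_comp => //.
  exact: measurable_funD.
have Gc : G t @[t --> 0%R] --> G 0%R.
  apply: cvg_norm; apply: (cvg_comp (fun t => t + pi * k.+1%:R)%R h); last exact: ch0.
  by apply: cvgD; [exact: cvg_id|exact: cvg_cst].
have GM t : (`|t| <= pi / 2 -> `|G t| <= fine (\int[mu]_x `|(derive1 h x)%:E|))%R.
  by move=> _; rewrite normr_id hM.
apply: (squeeze_cvge _ (cvg_cst 0) (laplace_cvg mG GM Gc)).
near=> n.
have n0 : (0 < n)%N by near: n; exact: nbhs_infty_gt.
apply/andP; split.
  by rewrite mule_ge0 ?lee_fin ?sqrtr_ge0//; apply: integral_ge0 => t _; rewrite lee_fin mulr_ge0// exprn_ge0.
apply: le_trans (@integral_blk_cos (fun t => `|h t|)%R n k n0 _ (fun=> normr_ge0 _)) _.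
  exact: measurableT_comp.
rewrite le_eqVlt; apply/orP; left; apply/eqP; apply: eq_integral => s _.
rewrite -/(G _) G0 mulr0 subr0 ger0_norm// indicE.
have [/set_mem/winP/cos_pow_bounds/andP[c0 _]|_] := boolP (_ \in _).
  by rewrite mul1r mulr_ge0// /G.
by rewrite mul0r.
Unshelve. all: by end_near. Qed.

Lemma cvg_tail : (Num.sqrt n%:R)%:E *
  \int[mu]_(t in `[(pi / 2)%R, +oo[) (`|cos t| ^+ n * `|h t|)%:E @[n --> \oo] --> 0.
Proof.
(* The series over the cells is written as an integral for the counting measure, so that dominated
   convergence applies to it. *)
have -> : (fun n => (Num.sqrt n%:R)%:E *
    \int[mu]_(t in `[(pi / 2)%R, +oo[) (`|cos t| ^+ n * `|h t|)%:E) =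
    (fun n => \int[counting]_k A n k).
  apply/funext => n; rewrite integral_tail.
  - rewrite -nneseriesZl; last first.
      by move=> k _; apply: integral_ge0 => t _; rewrite lee_fin mulr_ge0// exprn_ge0.
    rewrite ge0_integral_count// => k; rewrite mule_ge0 ?lee_fin ?sqrtr_ge0//.
    by apply: integral_ge0 => t _; rewrite lee_fin mulr_ge0// exprn_ge0.
  - by apply: measurable_funM; [exact: mcos|exact: measurableT_comp].
  - by move=> t; rewrite mulr_ge0// exprn_ge0.
have A0 n k : 0 <= A n k.
  rewrite mule_ge0 ?lee_fin ?sqrtr_ge0//.
  by apply: integral_ge0 => t _; rewrite lee_fin mulr_ge0// exprn_ge0.
(* The domination [A_le] starts at n = 1, whereas dominated convergence wants it for every index. *)
rewrite -(cvg_shiftn 1).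
have := @dominated_convergence _ nat R counting setT measurableT
  (fun n k => A (n + 1)%N k) (cst 0) (fun k => (Num.sqrt (2 * pi))%:E * m k).
case => //.
- by apply: aeW => k _; rewrite (@cvg_shiftn 1 _ (A ^~ k)).
- apply/integrableP; split => //.
  rewrite ge0_integral_count//; under eq_eseriesr do rewrite gee0_abs ?mule_ge0 ?lee_fin ?sqrtr_ge0//.
  by rewrite nneseriesZl// lte_mul_pinfty// lee_fin sqrtr_ge0.
- by apply: aeW => k n _; rewrite gee0_abs// A_le// addn1.
- by move=> _ _; rewrite integral0; exact.
Qed.

End tail.
End blocks.

(** * Assembling the centre and the two half-lines *)

Section two_sided.
Context {R : realType}.
Notation mu := (@lebesgue_measure R).
Local Open Scope ereal_scope.

Let W : set R := `[(- (pi / 2))%R, (pi / 2)%R].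

(** The points pi/2 and -pi/2 are counted on the right only; stating an inequality avoids discarding
    them as a null set. *)
Lemma le_integral_outside (f : R -> R) : measurable_fun setT f ->
  (forall t, 0 <= f t)%R ->
  \int[mu]_t (\1_(~` W) t * f t)%:E <=
  \int[mu]_(t in `[(pi / 2)%R, +oo[) (f t)%:E +
  \int[mu]_(t in `[(pi / 2)%R, +oo[) (f (- t)%R)%:E.
Proof.
move=> mf f0; set B : set R := `[(pi / 2)%R, +oo[%classic.
rewrite (integral_indicM B f) (integral_indicM B (fun t => f (- t)%R)).
have mB : measurable B by exact: measurable_itv.
have mfN : measurable_fun setT (fun t : R => f (- t)%R) by exact: measurableT_comp.
have mBf : measurable_fun setT (fun t : R => \1_B t * f t)%R.
  by apply: measurable_funM => //; exact: measurable_indic.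
have mBfN : measurable_fun setT (fun t : R => \1_B t * f (- t))%R.
  by apply: measurable_funM => //; exact: measurable_indic.
have mBfN' : measurable_fun setT (fun t : R => \1_B (- t) * f (- - t))%R.
  exact: (measurableT_comp mBfN).
rewrite (@ge0_integral_opp _ (fun t => (\1_B t * f (- t))%:E)); last 2 first.
- exact/measurable_EFinP.
- by move=> t; rewrite lee_fin mulr_ge0.
rewrite -ge0_integralD//; last 4 first.
- by move=> t _; rewrite lee_fin mulr_ge0.
- exact/measurable_EFinP.
- by move=> t _; rewrite lee_fin mulr_ge0.
- exact/measurable_EFinP.
apply: ge0_le_integral => //.
- by move=> t _; rewrite lee_fin mulr_ge0.
- apply/measurable_EFinP/measurable_funM => //; apply: measurable_indic.
  by apply: measurableC; exact: measurable_itv.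
- by apply: emeasurable_funD; exact/measurable_EFinP.
- move=> t _; rewrite -EFinD lee_fin opprK -mulrDl ler_wpM2r// !indicE.
  have [/set_mem/= tW|_] := boolP (t \in ~` W); last by rewrite addr_ge0.
  have [tB|tB] := boolP (t \in B); first by rewrite lerDl.
  rewrite mem_set ?lerDr//= /B/= in_itv/= andbT.
  move: tW tB; rewrite /W/= notin_setE /B/= !in_itv/= andbT => /negP tW /negP.
  by rewrite -ltNge => tB; move: tW; rewrite negb_and -!ltNge => /orP[|]; lra.
Qed.

Variable h : R -> R.
Hypotheses (dh : forall x, derivable h x 1) (ch : continuous (derive1 h))
  (ih' : mu.-integrable setT (EFin \o derive1 h))
  (h0 : forall k : nat, h (pi * k.+1%:R)%R = 0%R)
  (h0N : forall k : nat, h (- (pi * k.+1%:R))%R = 0%R).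

Let ch0 : continuous h.
Proof. by move=> x; apply/differentiable_continuous/derivable1_diffP. Qed.

Let mh : measurable_fun setT h.
Proof. exact: continuous_measurable_fun. Qed.

(** The reflection satisfies the same hypotheses as [h], so the tail of [h] at minus infinity is the
    tail of [hN] at plus infinity. *)
Let hN x := h (- x)%R.

Let is_derive_hN (x : R) : is_derive x 1%R hN (- derive1 h (- x))%R.
Proof.
rewrite -mulrN1 derive1E; apply: (@is_derive1_comp _ h -%R).
exact/derivableP.
Qed.

Let dhN x : derivable hN x 1.
Proof. by have [] := is_derive_hN x. Qed.

Let derive1hN : derive1 hN = (fun x => - derive1 h (- x))%R.
Proof. by apply/funext => x; rewrite derive1E; exact: derive_val. Qed.

Let chN : continuous (derive1 hN).
Proof.
rewrite derive1hN => x; apply: cvgN.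
apply: (cvg_comp -%R (derive1 h)); last exact: ch.
exact: opp_continuous.
Qed.

Let ihN : mu.-integrable setT (EFin \o derive1 hN).
Proof.
case/integrableP: ih' => mh' foo; apply/integrableP; split.
  by apply/measurable_EFinP; exact: continuous_measurable_fun.
rewrite derive1hN; under eq_integral do rewrite /= normrN.
rewrite -(@ge0_integral_opp _ (fun x => `|derive1 h x|%:E)) => [|//|//].
  exact: foo.
by apply/measurable_EFinP/measurableT_comp => //; exact/measurable_EFinP.
Qed.

Lemma integrable_of_derive1 : mu.-integrable setT (EFin \o h).
Proof.
apply/integrableP; split; first exact/measurable_EFinP.
have t1 := integrable_tail dh ch h0 ih'.
have t2 := integrable_tail dhN chN h0N ihN.
have mah : measurable_fun setT (fun t : R => `|h t|)%R by exact: measurableT_comp.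
have out := @le_integral_outside (fun t => `|h t|)%R mah (fun=> normr_ge0 _).
have out' := le_lt_trans out (lte_add_pinfty t1 t2).
have /integrableP[_ inn] : mu.-integrable W (EFin \o h).
  apply: continuous_compact_integrable; first exact: segment_compact.
  exact: continuous_subspaceT.
apply: le_lt_trans (lte_add_pinfty inn out').
rewrite -(integral_indicM (~` W) (fun t => `|h t|)%R) -[in leLHS](setUv W).
rewrite ge0_integral_setU//.
- exact: measurable_itv.
- by apply: measurableC; exact: measurable_itv.
- by apply: measurable_funTS; apply: measurableT_comp => //; exact/measurable_EFinP.
- by apply/disj_setPS; rewrite setICr.
Qed.

(** The analytic core: in the end [h] is the real or the imaginary part of the characteristic
    function, and this integral bounds its share of the uniform distance. *)
Lemma cvg_cos_pow_integral :
  \int[mu]_s `|cos (s / Num.sqrt n%:R) ^+ n * h (s / Num.sqrt n%:R) -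
    gauss s * h 0|%R%:E @[n --> \oo] --> 0.
Proof.
have t1 := cvg_tail dh ch h0 ih'.
have t2 := cvg_tail dhN chN h0N ihN.
have hM := norm_le_integral_derive1 dh ch ih' (h0 0).
have hc0 : h t @[t --> 0%R] --> h 0%R by exact: ch0.
have L := laplace_cvg mh (fun t _ => hM t) hc0.
have t12 := cvgeD (isT : (0%R : \bar R) +? 0) t1 t2; rewrite adde0 in t12.
have U := cvgeD (isT : (0%R : \bar R) +? 0) L (t12 eventually_filter); rewrite adde0 in U.
apply: (squeeze_cvge _ (cvg_cst 0) (U eventually_filter)) => //.
near=> n.
have n0 : (0 < n)%N by near: n; exact: nbhs_infty_gt.
have n0' : (0 < Num.sqrt n%:R :> R)%R by rewrite sqrtr_gt0 ltr0n.
rewrite integral_ge0//=.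
pose c : R := Num.sqrt n%:R.
pose F t := (\1_(~` W) t * (`|cos t| ^+ n * `|h t|))%R.
have mh' : measurable_fun setT (fun t => `|cos t| ^+ n * `|h t|)%R.
  apply: measurable_funM; last exact: measurableT_comp.
  apply: measurable_funX; apply: measurableT_comp => //.
  by apply: continuous_measurable_fun; exact: continuous_cos.
have mF : measurable_fun setT F.
  apply: measurable_funM => //; apply: measurable_indic.
  by apply: measurableC; exact: measurable_itv.
have F0 t : (0 <= F t)%R by rewrite mulr_ge0// mulr_ge0// exprn_ge0.
have FE : \int[mu]_s (F (s / c))%:E = c%:E * \int[mu]_t (F t)%:E.
  rewrite (@ge0_integral_affine _ c^-1%R 0%R (EFin \o F)) ?invr_gt0//; last exact/measurable_EFinP.
  rewrite muleA -EFinM divff ?gt_eqF// mul1e.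
  by apply: eq_integral => s _; rewrite /= addr0 mulrC.
have mFc : measurable_fun setT (fun s : R => F (s / c))%R.
  by apply: measurableT_comp => //; exact: measurable_funM.
have mgs : measurable_fun setT (fun s : R => gauss s * h 0)%R.
  by apply: measurable_funM => //; exact: measurable_gauss.
have mcs : measurable_fun setT (fun s : R => cos (s / c) ^+ n * h (s / c))%R.
  apply: measurable_funM; first exact: measurable_cos_pow.
  by apply: measurableT_comp => //; exact: measurable_funM.
have mws : measurable_fun setT (fun s : R => `|\1_(win n) s * (cos (s / c) ^+ n * h (s / c)) - gauss s * h 0|)%R.
  apply: measurableT_comp => //; apply: measurable_funB => //.
  by apply: measurable_funM => //; apply: measurable_indic; exact: measurable_itv.
(* Inside the window the first term is already the whole integrand. Outside, the indicator kills the
   cosine part there, leaving the Gaussian tail, and [F] accounts for the cosine part. *)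
apply: (@le_trans _ _ (\int[mu]_s (`|\1_(win n) s * (cos (s / c) ^+ n * h (s / c)) - gauss s * h 0|%:E +
   (F (s / c))%:E))).
  apply: ge0_le_integral => //.
  - apply/measurable_EFinP; apply: measurableT_comp => //.
    exact: measurable_funB.
  - by apply: emeasurable_funD; exact/measurable_EFinP.
  - move=> s _; rewrite -EFinD lee_fin.
    have sc : (`|s / c| = `|s| / c)%R by rewrite normf_div (gtr0_norm n0').
    rewrite /F !indicE; have [/set_mem/winP sw|sw] := boolP (s \in win n).
      by rewrite mul1r lerDl mulr_ge0// mulr_ge0// exprn_ge0.
    rewrite mem_set; last first.
      move=> sW; move: sw; rewrite notin_setE; apply; apply/winP.
      by move: sW; rewrite /W/= in_itv/= -ler_norml sc ler_pdivrMr.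
    rewrite mul0r mul1r sub0r normrN -normrX -normrM [leRHS]addrC.
    exact: ler_normB.
rewrite ge0_integralD//; first last.
- exact/measurable_EFinP.
- by move=> s _; rewrite lee_fin.
- exact/measurable_EFinP.
rewrite leeD2l// FE -muleDr ?ge0_adde_def ?inE ?integral_ge0//.
rewrite lee_pmul2l//.
apply: le_trans (le_integral_outside mh' _) _ => [t|].
  by rewrite mulr_ge0// exprn_ge0.
by under [X in _ + X <= _]eq_integral do rewrite cosN.
Unshelve. all: by end_near. Qed.

End two_sided.

(** * The Fourier transform of the Gaussian *)

Section gauss_fourier.
Context {R : realType}.
Notation mu := (@lebesgue_measure R).

(** Half of the exponent absorbs the factor: |s| <= 1 + s^2/4 <= e^(s^2/4), the first inequality
    being (|s| - 2)^2 >= 0. *)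
Lemma abs_gauss_le (s : R) : `|s| * gauss s <= gauss (s / Num.sqrt 2).
Proof.
have -> : gauss s = expR (- (s ^+ 2 / 4)) * gauss (s / Num.sqrt 2).
  by rewrite /gauss -expRD exprMn exprVn sqr_sqrtr//; congr expR; field.
rewrite mulrA ler_piMl ?gauss_ge0// expRN ler_pdivrMr ?expR_gt0// mul1r.
apply: le_trans (expR_ge1Dx _).
have -> : s ^+ 2 = `|s| ^+ 2 by rewrite real_normK ?num_real.
by have := sqr_ge0 (`|s| - 2); rewrite sqrrB; lra.
Qed.

Lemma integrable_abs_gauss : mu.-integrable setT (fun s => (`|s| * gauss s)%:E).
Proof.
have i2 := @integrable_affine R (Num.sqrt 2)^-1 0 _ _ integrable_gauss.
apply: (le_integrable measurableT _ _ (i2 _)) => //.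
- by apply/measurable_EFinP/measurable_funM => //; exact: measurable_gauss.
- move=> s _; rewrite /= lee_fin addr0 (mulrC _ s).
  by rewrite (ger0_norm (gauss_ge0 _)) ger0_norm ?mulr_ge0 ?gauss_ge0// abs_gauss_le.
Qed.

Lemma integrable_bounded_gauss (f : R -> R) : measurable_fun setT f ->
  (forall s, `|f s| <= 1) -> mu.-integrable setT (fun s => (gauss s * f s)%:E).
Proof.
move=> mf f1; apply: (le_integrable measurableT _ _ integrable_gauss).
  by apply/measurable_EFinP/measurable_funM => //; exact: measurable_gauss.
move=> s _; rewrite lee_fin normrM ler_piMr//.
Qed.

(** Integration by parts without boundary terms: the integrals over [-n, n] are f(n) - f(-n), and
    they tend to the full integral by dominated convergence. *)
Lemma Rintegral_derive1_eq0 (f : R -> R) :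
  (forall x, derivable f x 1) -> continuous (derive1 f) ->
  mu.-integrable setT (EFin \o derive1 f) ->
  f n%:R @[n --> \oo] --> 0 -> f (- n%:R) @[n --> \oo] --> 0 ->
  \int[mu]_x derive1 f x = 0.
Proof.
move=> df cf fi f1 f2.
have mf : measurable_fun setT (derive1 f) by exact: continuous_measurable_fun.
have [|||||_ _] := @dominated_convergence _ _ _ mu setT measurableT
  (fun n x => (\1_(`[- n%:R, n%:R] : set R) x * derive1 f x)%:E)
  (EFin \o derive1 f) (fun x => `|(derive1 f x)%:E|%E).
- by move=> n; apply/measurable_EFinP/measurable_funM.
- exact/measurable_EFinP.
- apply: aeW => x _; apply: cvg_near_cst; near=> n.
  rewrite indicE mem_set ?mul1r//= in_itv/= -ler_norml.
  by near: n; exact: nbhs_infty_ger.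
- by have := integrable_abse fi.
- apply: aeW => x n _; rewrite lee_fin normrM indicE.
  by case: (_ \in _); rewrite ?normr1 ?normr0 ?mul1r ?mul0r.
have -> : [sequence (\int[mu]_x (\1_(`[- n%:R, n%:R] : set R) x * derive1 f x)%:E)%E]_n =
    (fun n => (f n%:R - f (- n%:R))%:E).
  apply/funext => n /=; rewrite -integral_indicM.
  (* The fundamental theorem of calculus is stated for a nondegenerate interval, so n = 0 is treated
     apart. *)
  have [->|n0] := posnP n.
    by rewrite oppr0 set_itv1 integral_set1 subrr.
  have nn : - n%:R < n%:R :> R.
    by rewrite -subr_gt0 opprK -natrD ltr0n addn_gt0 n0.
  have drv : derivable_oo_LRcontinuous f (- n%:R) n%:R.
    have cc : continuous f by move=> x; apply/differentiable_continuous/derivable1_diffP.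
    split; first by move=> x _; exact: df.
      by apply: cvg_at_right_filter; exact: cc.
    by apply: cvg_at_left_filter; exact: cc.
  by rewrite (continuous_FTC2 nn (continuous_subspaceT cf) drv (fun _ _ => erefl)) EFinB.
move=> h.
have h0 : (f n%:R - f (- n%:R))%:E @[n --> \oo] --> (0 - 0)%:E.
  by apply: cvg_EFin; [exact: nearW|exact: cvgB].
by rewrite /Rintegral -(cvg_lim _ h)// (cvg_lim _ h0)// subrr.
Unshelve. all: by end_near. Qed.

Lemma gaussN (s : R) : gauss (- s) = gauss s.
Proof. by rewrite /gauss sqrrN. Qed.

Lemma cvg_gauss_bounded (u : nat -> R) : (forall n, `|u n| <= 1) ->
  gauss n%:R * u n @[n --> \oo] --> 0.
Proof.
move=> u1; apply: norm_cvg0.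
apply: (squeeze_cvgr _ (cvg_cst 0) (@cvgn_expR R)).
near=> n; rewrite normr_ge0/= normrM (ger0_norm (gauss_ge0 _)).
apply: (@le_trans _ _ (gauss n%:R)); first by rewrite ler_piMr ?gauss_ge0.
(* For n >= 2 one has n <= n^2/2, so the Gaussian at n is at most e^(-n). *)
rewrite ler_expR lerN2 expr2 mulrAC ler_peMl// ler_pdivlMr// mul1r.
by near: n; exact: nbhs_infty_ger.
Unshelve. all: by end_near. Qed.

Lemma is_derive_gauss_sin (s y : R) :
  is_derive s (1 : R) (fun s => gauss s * sin (s * y))
    (y * (gauss s * cos (s * y)) - s * gauss s * sin (s * y)).
Proof.
apply: is_derive_eq; rewrite /GRing.scale/=.
by move: (cos _) (sin _) (gauss s) => a b c; ring.
Qed.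

Lemma continuous_derive_gauss_sin (y : R) :
  continuous (fun s => y * (gauss s * cos (s * y)) - s * gauss s * sin (s * y)).
Proof.
by move=> s; apply: differentiable_continuous; exact/derivable1_diffP.
Qed.

Lemma is_derive_gauss_cos (s y : R) :
  is_derive y (1 : R) (fun y => gauss s * cos (s * y)) (- (s * gauss s * sin (s * y))).
Proof. by apply: is_derive_eq; rewrite /GRing.scale/=; ring. Qed.

(** The product f(y) e^(y^2/2) has zero derivative, hence is constant. *)
Lemma gauss_ode (f : R -> R) : (forall y : R, is_derive y (1 : R) f (- (y * f y))) ->
  forall x, f x = f 0 * gauss x.
Proof.
move=> df x.
have dM (y : R) : is_derive y (1 : R) (fun y => f y * expR (y ^+ 2 / 2)) 0.
  by apply: is_derive_eq; rewrite /GRing.scale/=; field.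
have := is_derive_0_is_cst x 0 dM.
rewrite expr0n/= mul0r expR0 mulr1 => <-.
by rewrite /gauss -mulrA -expRD subrr expR0 mulr1.
Qed.

(* The transform [K] satisfies [K' = - y K], by an integration by parts. *)
Let K (x : R) := \int[mu]_s (gauss s * cos (s * x)).

Lemma gauss_fourier x : \int[mu]_s (gauss s * cos (s * x)) = Num.sqrt (2 * pi) * gauss x.
Proof.
have mcos (y : R) : measurable_fun setT (fun s : R => cos (s * y)).
  apply: measurableT_comp; last exact: measurable_funM.
  by apply: continuous_measurable_fun; exact: continuous_cos.
have msin (y : R) : measurable_fun setT (fun s : R => sin (s * y)).
  apply: measurableT_comp; last exact: measurable_funM.
  by apply: continuous_measurable_fun; exact: continuous_sin.
have ic y : mu.-integrable setT (fun s => (gauss s * cos (s * y))%:E).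
  by apply: integrable_bounded_gauss => // s; exact: cos_max.
have p1 (y s : R) : partial1of2 (fun y s => gauss s * cos (s * y)) y s = - (s * gauss s * sin (s * y)).
  by rewrite /partial1of2 derive1E (@derive_val _ _ _ _ _ _ _ (is_derive_gauss_cos s y)).
have is_ y : mu.-integrable setT (fun s => (s * gauss s * sin (s * y))%:E).
  apply: (le_integrable measurableT _ _ integrable_abs_gauss).
    apply/measurable_EFinP/measurable_funM; last exact: msin.
    by apply: measurable_funM => //; exact: measurable_gauss.
  move=> s _; rewrite lee_fin !normrM normr_id -[leRHS]mulr1.
  by rewrite ler_wpM2l ?mulr_ge0//; exact: sin_max.
(* The derivative of s |-> [gauss s * sin (s * y)] integrates to 0, and its two terms are the two
   sides. *)
have IBP y : \int[mu]_s (s * gauss s * sin (s * y)) = y * K y.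
  have dPhi := @is_derive_gauss_sin ^~ y.
  have dE : derive1 (fun s => gauss s * sin (s * y)) =
      (fun s => y * (gauss s * cos (s * y)) - s * gauss s * sin (s * y)).
    by apply/funext => s; rewrite derive1E; exact: derive_val.
  have iZ : mu.-integrable setT (EFin \o (fun s => y * (gauss s * cos (s * y)))).
    rewrite (_ : _ \o _ = (fun s => y%:E * (gauss s * cos (s * y))%:E)%E)//.
    by apply: integrableZl => //; exact: ic.
  have : \int[mu]_s derive1 (fun s => gauss s * sin (s * y)) s = 0.
    apply: Rintegral_derive1_eq0.
    - by move=> s; have [] := dPhi s.
    - by rewrite dE; exact: continuous_derive_gauss_sin.
    - rewrite dE (_ : _ \o _ = ((EFin \o (fun s => y * (gauss s * cos (s * y)))%R) \-
        (EFin \o (fun s => s * gauss s * sin (s * y))%R))%E)//.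
      by apply: integrableB => //; exact: is_.
    - by apply: cvg_gauss_bounded => n; exact: sin_max.
    - under eq_fun do rewrite gaussN.
      by apply: cvg_gauss_bounded => n; exact: sin_max.
  rewrite dE RintegralB//; last exact: is_.
  rewrite RintegralZl//; last exact: ic.
  by move/eqP; rewrite subr_eq0 => /eqP <-.
(* Differentiation under the integral, dominated by |s| e^(-s^2/2); the interval around [y] only
   localizes it. *)
have dK y : is_derive y (1 : R) K (- (y * K y)).
  have yI : [set` `]y - 1, y + 1[] y by rewrite /= in_itv/= ltrBlDr !ltrDl ltr01.
  have F1 (z s : R) : [set` `]y - 1, y + 1[] z -> [set: R] s ->
      derivable ((fun z s => gauss s * cos (s * z)) ^~ s) z 1.
    by move=> _ _; have [] := is_derive_gauss_cos s z.
  have F2 (z s : R) : [set` `]y - 1, y + 1[] z -> [set: R] s ->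
      `|partial1of2 (fun z s => gauss s * cos (s * z)) z s| <= `|s| * gauss s.
    move=> _ _; rewrite p1 normrN !normrM (ger0_norm (gauss_ge0 s)).
    by rewrite -[leRHS]mulr1 ler_wpM2l ?mulr_ge0 ?gauss_ge0//; exact: sin_max.
  have G0 (s : R) : 0 <= `|s| * gauss s by rewrite mulr_ge0 ?gauss_ge0.
  apply: DeriveDef.
    exact: (derivable_under_integral measurableT yI (fun z _ => ic z) F1 G0 integrable_abs_gauss F2).
  rewrite -derive1E (differentiation_under_integral measurableT yI (fun z _ => ic z) F1 G0 integrable_abs_gauss F2).
  rewrite -IBP -[RHS]mulN1r -RintegralZl//; last exact: is_.
  by apply: eq_Rintegral => s _; rewrite p1 mulN1r.
have Kx := gauss_ode dK x.
have K0 : K 0 = Num.sqrt (2 * pi).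
  rewrite /K /Rintegral; under eq_integral do rewrite mulr0 cos0 mulr1.
  by rewrite integral_gauss.
by rewrite -K0 -Kx.
Qed.

End gauss_fourier.

(** * Characteristic functions and inversion *)

Section charfun_components.
Context d (T : measurableType d) (R : realType) (P : probability T R).
Variable X : {RV P >-> R}.
Implicit Types t : R.

Lemma Re_charfunE t : complex.Re (charfun P X t) = \int[P]_w cos (t * X w).
Proof. by rewrite /charfun /cexpectation /= unlock. Qed.

Lemma Im_charfunE t : complex.Im (charfun P X t) = \int[P]_w sin (t * X w).
Proof. by rewrite /charfun /cexpectation /= unlock. Qed.

Lemma measurable_cosX t : measurable_fun setT (fun w => cos (t * X w)).
Proof.
apply: measurableT_comp; last exact: measurable_funM.
by apply: continuous_measurable_fun; exact: continuous_cos.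
Qed.

Lemma measurable_sinX t : measurable_fun setT (fun w => sin (t * X w)).
Proof.
apply: measurableT_comp; last exact: measurable_funM.
by apply: continuous_measurable_fun; exact: continuous_sin.
Qed.

Lemma integrable_le1 (f : T -> R) : measurable_fun setT f ->
  (forall w, `|f w| <= 1) -> P.-integrable setT (EFin \o f).
Proof.
move=> mf f1; apply: (@le_integrable _ _ _ _ _ measurableT _ (EFin \o cst 1)).
- exact/measurable_EFinP.
- by move=> w _; rewrite /= lee_fin normr1.
- exact: finite_measure_integrable_cst.
Qed.

Lemma integrable_cosX t : P.-integrable setT (fun w => (cos (t * X w))%:E).
Proof. by apply: integrable_le1 => [|w]; [exact: measurable_cosX|exact: cos_max]. Qed.

Lemma integrable_sinX t : P.-integrable setT (fun w => (sin (t * X w))%:E).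
Proof. by apply: integrable_le1 => [|w]; [exact: measurable_sinX|exact: sin_max]. Qed.

Hypothesis X1 : P.-integrable setT (EFin \o X).

Let G w := `|X w|.

Let intG : P.-integrable setT (EFin \o G).
Proof. exact: integrable_norm. Qed.

Let G0 w : 0 <= G w. Proof. exact: normr_ge0. Qed.

Section component.
Variables (phi dphi : R -> R).
Hypotheses (dP : forall y : R, is_derive y (1 : R) phi (dphi y))
  (cphi : continuous phi) (cdphi : continuous dphi)
  (phi1 : forall y, `|phi y| <= 1) (dphi1 : forall y, `|dphi y| <= 1).

Let f t w := phi (t * X w).

Let intf t : P.-integrable setT (EFin \o f t).
Proof.
apply: integrable_le1 => [|w]; last exact: phi1.
apply: measurableT_comp; last exact: measurable_funM.
exact: continuous_measurable_fun.
Qed.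

Let df t w : is_derive t (1 : R) (f ^~ w) (dphi (t * X w) * X w).
Proof.
apply: (@is_derive1_comp _ phi (fun t => t * X w)).
by apply: is_derive_eq; rewrite /GRing.scale/=; ring.
Qed.

Let p1 t w : partial1of2 f t w = dphi (t * X w) * X w.
Proof. by rewrite /partial1of2 derive1E (@derive_val _ _ _ _ _ _ _ (df t w)). Qed.

Let F1 t w (I : set R) : I t -> [set: T] w -> derivable (f ^~ w) t 1.
Proof. by move=> _ _; have [] := df t w. Qed.

Let F2 t w (I : set R) : I t -> [set: T] w -> `|partial1of2 f t w| <= G w.
Proof. by move=> _ _; rewrite p1 normrM ler_piMl. Qed.

Let tI t : `]t - 1, t + 1[%classic t.
Proof. by rewrite /= in_itv/= ltrBlDr !ltrDl ltr01. Qed.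

(** Differentiation under the expectation is dominated by |X|, as [dphi] is bounded by 1. Keeping
    [phi] abstract lets cos and sin, that is, the real and imaginary parts of the characteristic
    function, be two instances. *)
Lemma derivable_expectation t : derivable (fun t => \int[P]_w phi (t * X w)) t 1.
Proof.
exact: (derivable_under_integral measurableT (tI t) (fun z _ => intf z)
  (fun t w => @F1 t w _) G0 intG (fun t w => @F2 t w _)).
Qed.

Lemma derive1_expectation t : derive1 (fun t => \int[P]_w phi (t * X w)) t =
  \int[P]_w (dphi (t * X w) * X w).
Proof.
rewrite (differentiation_under_integral measurableT (tI t) (fun z _ => intf z)
  (fun t w => @F1 t w _) G0 intG (fun t w => @F2 t w _)).
by apply: eq_Rintegral => w _; exact: p1.
Qed.

Lemma continuous_derive1_expectation :
  continuous (derive1 (fun t => \int[P]_w phi (t * X w))).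
Proof.
rewrite (_ : derive1 _ = fun t => \int[P]_w (dphi (t * X w) * X w)); last first.
  by apply/funext => t; exact: derive1_expectation.
have m t : measurable_fun setT (fun w => dphi (t * X w) * X w).
  apply: measurable_funM => //; apply: measurableT_comp; last exact: measurable_funM.
  exact: continuous_measurable_fun.
have b t w : `|dphi (t * X w) * X w| <= G w by rewrite normrM ler_piMl.
move=> t.
have := @continuity_under_integral R _ T P (fun t w => dphi (t * X w) * X w)
  setT measurableT (t - 1) (t + 1) _ _ G intG _ t.
apply => //.
- move=> x _; apply: (le_integrable measurableT _ _ intG); first exact/measurable_EFinP.
  by move=> w _; rewrite lee_fin (ger0_norm (G0 w)).
- apply: aeW => w _ x _; apply: cvgM; last exact: cvg_cst.
  apply: (cvg_comp (fun x => x * X w) dphi); last exact: cdphi.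
  by apply: cvgM; [exact: cvg_id|exact: cvg_cst].
- by move=> x _; apply: aeW => w _.
- by rewrite inE; exact: tI.
Qed.

End component.

Lemma Re_charfun_C1 :
  (forall t, derivable (fun t => complex.Re (charfun P X t)) t 1) /\
  continuous (derive1 (fun t => complex.Re (charfun P X t))).
Proof.
have -> : (fun t => complex.Re (charfun P X t)) = (fun t => \int[P]_w cos (t * X w)).
  by apply/funext => t; exact: Re_charfunE.
have cN : continuous (fun x : R => - sin x).
  by move=> x; apply: cvgN; exact: continuous_sin.
have bN y : `|- sin y : R| <= 1 by rewrite normrN sin_max.
split=> [t|].
- by apply: (derivable_expectation _ (@continuous_cos R) (@cos_max R) bN).
- exact: (continuous_derive1_expectation _ (@continuous_cos R) cN (@cos_max R) bN).
Qed.

Lemma Im_charfun_C1 :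
  (forall t, derivable (fun t => complex.Im (charfun P X t)) t 1) /\
  continuous (derive1 (fun t => complex.Im (charfun P X t))).
Proof.
have -> : (fun t => complex.Im (charfun P X t)) = (fun t => \int[P]_w sin (t * X w)).
  by apply/funext => t; exact: Im_charfunE.
split=> [t|].
- by apply: (derivable_expectation _ (@continuous_sin R) (@sin_max R) (@cos_max R)).
- exact: (continuous_derive1_expectation _ (@continuous_sin R) (@continuous_cos R) (@sin_max R) (@cos_max R)).
Qed.

End charfun_components.

Section charfun_at0.
Context d (T : measurableType d) (R : realType) (P : probability T R).
Variable X : {RV P >-> R}.

Lemma Re_charfun0 : complex.Re (charfun P X 0) = 1.
Proof.
rewrite Re_charfunE /Rintegral; under eq_integral do rewrite mul0r cos0.
by rewrite integral_cst//= mul1e probability_setT.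
Qed.

Lemma Im_charfun0 : complex.Im (charfun P X 0) = 0.
Proof.
rewrite Im_charfunE /Rintegral; under eq_integral do rewrite mul0r sin0.
by rewrite integral0.
Qed.

End charfun_at0.

Section Rintegral_extra.
Context d (T : measurableType d) (R : realType) (mu : {measure set T -> \bar R}).

Lemma EFin_Rintegral (D : set T) (f : T -> R) : measurable D ->
  mu.-integrable D (EFin \o f) ->
  (\int[mu]_(x in D) f x)%:E = (\int[mu]_(x in D) (f x)%:E)%E.
Proof. by move=> mD fi; rewrite /Rintegral fineK// integrable_fin_num. Qed.

End Rintegral_extra.

(** * Inversion formula with a Gaussian cutoff *)

Section inversion.
Context d (T : measurableType d) (R : realType) (P : probability T R).
Notation mu := (@lebesgue_measure R).
Variable X : {RV P >-> R}.

Let a t := complex.Re (charfun P X t).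
Let b t := complex.Im (charfun P X t).

(** The real part of e^(-itx) f(t). The imaginary part is odd in t and would contribute nothing to
    the integral. *)
Definition fourier_kernel x t := a t * cos (t * x) + b t * sin (t * x).

Lemma fourier_kernelE x t : fourier_kernel x t = \int[P]_w cos (t * (x - X w)).
Proof.
rewrite /fourier_kernel /a /b Re_charfunE Im_charfunE mulrC (mulrC _ (sin _)).
rewrite -RintegralZl//; last exact: integrable_cosX.
rewrite -RintegralZl//; last exact: integrable_sinX.
rewrite -RintegralD//; last 2 first.
  apply: integrable_le1 => [|w].
    by apply: measurable_funM => //; exact: measurable_cosX.
  by rewrite normrM mulr_ile1// cos_max.
  apply: integrable_le1 => [|w].
    by apply: measurable_funM => //; exact: measurable_sinX.
  by rewrite normrM mulr_ile1// sin_max.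
by apply: eq_Rintegral => w _; rewrite mulrBr cosB.
Qed.

Lemma integrable_gauss_cos (e y : R) : 0 < e ->
  mu.-integrable setT (EFin \o (fun t => gauss (e * t) * cos (t * y))).
Proof.
move=> e0.
have := @integrable_affine R e 0 (fun s => (gauss s * cos (s * (y / e)))%:E) e0 _.
move=> h; apply: eq_integrable (h _) => //.
  by move=> t _ /=; rewrite addr0; congr (_ * cos _)%:E; field; rewrite gt_eqF.
apply: integrable_bounded_gauss; last by move=> s; exact: cos_max.
apply: measurableT_comp; last exact: measurable_funM.
by apply: continuous_measurable_fun; exact: continuous_cos.
Qed.

Lemma gauss_fourier_scale (e y : R) : 0 < e ->
  \int[mu]_t (gauss (e * t) * cos (t * y)) = 2 * pi * normal_pdf 0 e y.
Proof.
move=> e0.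
have ic := integrable_gauss_cos y e0.
rewrite (@Rintegral_affine _ e^-1 0 _ _ ic) ?invr_gt0//.
rewrite [X in _ * X](_ : _ = \int[mu]_t (gauss t * cos (t * (y / e)))); last first.
  apply: eq_Rintegral => t _; rewrite addr0.
  by congr (gauss _ * cos _); field; rewrite gt_eqF.
rewrite gauss_fourier normal_pdfE_gauss// invfM.
have : Num.sqrt (2 * pi) ^+ 2 = 2 * pi :> R.
  by rewrite sqr_sqrtr// mulr_ge0// pi_ge0.
move: (@sqrt2pi_gt0 R); set r := Num.sqrt _ => r0 <-.
by field; rewrite !gt_eqF.
Qed.

(* The Gaussian factor makes the double integral absolutely convergent, so that
   Fubini applies. *)
Lemma smoothed_inversion (e x : R) : 0 < e ->
  \int[mu]_t (gauss (e * t) * fourier_kernel x t) =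
  2 * pi * \int[P]_w normal_pdf 0 e (x - X w).
Proof.
move=> e0.
pose F (z : R * T) := (gauss (e * z.1) * cos (z.1 * (x - X z.2)))%:E.
have mF : measurable_fun setT F.
  apply/measurable_EFinP/measurable_funM.
    apply: (measurableT_comp measurable_gauss); apply: measurable_funM => //.
  apply: measurableT_comp.
    by apply: continuous_measurable_fun; exact: continuous_cos.
  apply: measurable_funM => //; apply: measurable_funB => //.
  exact: measurableT_comp.
have ig : mu.-integrable setT (fun t => (gauss (e * t))%:E).
  apply: eq_integrable (@integrable_affine R e 0 (EFin \o gauss) e0 integrable_gauss) => //.
  by move=> t _ /=; rewrite addr0.
have iF : (mu \x P)%E.-integrable setT F.
  apply/integrable12ltyP => //.
  case/integrableP: ig => mg; apply: le_lt_trans.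
  apply: ge0_le_integral => //.
  - by move=> t _; exact: integral_ge0.
  - apply: (measurable_fun_fubini_tonelli_F (abse \o F)) => //.
      exact: measurableT_comp.
    by move=> z; exact: abse_ge0.
  - exact: measurableT_comp.
  move=> t _; apply: (@le_trans _ _ (\int[P]_w (cst (gauss (e * t))%:E w))%E).
    apply: ge0_le_integral => //.
    - apply: measurableT_comp => //; by apply: (measurableT_comp mF); exact: pair1_measurable.
    move=> w _; rewrite /F/= lee_fin normrM (ger0_norm (gauss_ge0 _)).
    by rewrite ler_piMr ?gauss_ge0 ?cos_max.
  rewrite integral_cst//= probability_setT mule1.
  by rewrite lee_fin ger0_norm ?gauss_ge0.
have iFw t : P.-integrable setT (fun w => F (t, w)).
  rewrite (_ : (fun w => _) = (fun w => (gauss (e * t))%:E * (cos (t * (x - X w)))%:E)%E)//.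
  apply: integrableZl => //; apply: integrable_le1 => [|w]; last exact: cos_max.
  apply: measurableT_comp; last by apply: measurable_funM => //; exact: measurable_funB.
  by apply: continuous_measurable_fun; exact: continuous_cos.
have iFt w : mu.-integrable setT (fun t => F (t, w)) by exact: (integrable_gauss_cos (x - X w) e0).
have E1 t : (\int[P]_w F (t, w))%E = (gauss (e * t) * fourier_kernel x t)%:E.
  have <- := @EFin_Rintegral _ _ _ P setT (fun w => gauss (e * t) * cos (t * (x - X w)))
    measurableT (iFw t).
  congr EFin; rewrite fourier_kernelE RintegralZl//.
  apply: integrable_le1 => [|w]; last exact: cos_max.
  apply: measurableT_comp; last by apply: measurable_funM => //; exact: measurable_funB.
  by apply: continuous_measurable_fun; exact: continuous_cos.
have E2 w : (\int[mu]_t F (t, w))%E = (2 * pi * normal_pdf 0 e (x - X w))%:E.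
  have <- := @EFin_Rintegral _ _ _ mu setT (fun t => gauss (e * t) * cos (t * (x - X w)))
    measurableT (iFt w).
  by congr EFin; exact: gauss_fourier_scale.
have := Fubini iF.
under eq_integral do rewrite E1.
under [in X in _ = X -> _]eq_integral do rewrite E2.
move=> FF.
have iN : P.-integrable setT (EFin \o (fun w => normal_pdf 0 e (x - X w))).
  apply: (@le_integrable _ _ _ _ _ measurableT _ (EFin \o cst (normal_peak e))).
  - apply/measurable_EFinP; apply: measurableT_comp; last exact: measurable_funB.
    exact: measurable_normal_pdf.
  - move=> w _; rewrite /= lee_fin !ger0_norm ?normal_pdf_ge0 ?normal_peak_ge0//.
    by rewrite normal_pdf_ub ?gt_eqF.
  - exact: finite_measure_integrable_cst.
by rewrite -RintegralZl// /Rintegral FF.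
Qed.

End inversion.

(** * Gaussian smoothing of the indicator of an interval *)

Section smoothing.
Context {R : realType}.
Notation mu := (@lebesgue_measure R).
Local Open Scope ereal_scope.
Implicit Types (c d y z : R).

Definition eps (n : nat) : R := n.+1%:R^-1.

Lemma eps_gt0 n : (0 < eps n)%R. Proof. by rewrite invr_gt0. Qed.

Lemma cvg_eps : eps n @[n --> \oo] --> 0%R. Proof. exact: cvg_harmonic. Qed.

(** The substitution x = e z + y moves the width [e] from the density into the indicator; the
    integrand is then dominated by the standard normal density, whatever [e] is. *)
Lemma integral_normal_pdf_affine (A : set R) (e y : R) : (0 < e)%R -> measurable A ->
  \int[mu]_x (\1_A x * normal_pdf 0 e (x - y))%:E =
  \int[mu]_z (\1_A (e * z + y)%R * normal_pdf 0 1 z)%:E.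
Proof.
move=> e0 mA.
have mN (s : R) : measurable_fun setT (normal_pdf 0 s) by exact: measurable_normal_pdf.
rewrite (@ge0_integral_affine _ e y)//; last 2 first.
- apply/measurable_EFinP/measurable_funM; first exact: measurable_indic.
  by apply: measurableT_comp => //; exact: measurable_funB.
- by move=> x; rewrite lee_fin mulr_ge0// normal_pdf_ge0.
rewrite -ge0_integralZl_EFin//; last 3 first.
- by move=> z _; rewrite lee_fin mulr_ge0// normal_pdf_ge0.
- apply/measurable_EFinP/measurable_funM.
    by apply: (measurableT_comp (measurable_indic mA)); exact: measurable_affine.
  apply: measurableT_comp => //; apply: measurable_funB => //; exact: measurable_affine.
- exact: ltW.
apply: eq_integral => z _; rewrite -EFinM addrK !normal_pdfE_gauss// divr1.
rewrite (_ : e * z / e = z)%R; last by field; rewrite gt_eqF.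
congr EFin; have := @sqrt2pi_gt0 R; set r := Num.sqrt _ => r0.
by field; rewrite !gt_eqF.
Qed.

Lemma cvg_smoothed_indic c d y : y != c -> y != d ->
  \int[mu]_x (\1_(`]c, d] : set R) x * normal_pdf 0 (eps n) (x - y))%:E @[n --> \oo] -->
  (\1_(`]c, d] : set R) y)%:E.
Proof.
move=> yc yd; set A : set R := `]c, d]%classic.
have mN : measurable_fun setT (@normal_pdf R 0 1) by exact: measurable_normal_pdf.
have mA : measurable A by exact: measurable_itv.
under eq_fun => n do rewrite (integral_normal_pdf_affine _ (eps_gt0 n) mA).
have [|||||_ _] := @dominated_convergence _ _ _ mu setT measurableT
  (fun n z => (\1_A (eps n * z + y)%R * normal_pdf 0 1 z)%:E)
  (fun z => (\1_A y * normal_pdf 0 1 z)%:E) (fun z => (normal_pdf 0 1 z)%:E).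
- move=> n; apply/measurable_EFinP/measurable_funM => //.
  by apply: (measurableT_comp (measurable_indic mA)); exact: measurable_affine.
- by apply/measurable_EFinP/measurable_funM.
- apply: aeW => z _; apply: cvg_near_cst.
  have ez : (eps n * z + y)%R @[n --> \oo] --> y.
    rewrite -[X in _ --> X]add0r -(mul0r z).
    by apply: cvgD; [apply: cvgM; [exact: cvg_eps|exact: cvg_cst]|exact: cvg_cst].
  have itvE (x : R) : (x \in A) = (c < x <= d)%R by rewrite mem_setE in_itv.
  (* As [y] is not an endpoint, each of the two comparisons eventually has the truth value it has at
     [y]. *)
  have cE : \forall n \near \oo, (c < eps n * z + y)%R = (c < y)%R.
    have [cy|cy|cy] := ltgtP c y.
    - by near=> n; near: n; exact: (cvgr_gt _ ez).
    - near=> n; apply/negbTE; rewrite -leNgt ltW//; near: n.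
      exact: (cvgr_lt _ ez).
    - by rewrite cy eqxx in yc.
  have dE : \forall n \near \oo, (eps n * z + y <= d)%R = (y <= d)%R.
    have [dy|dy|dy] := ltgtP y d.
    - near=> n; rewrite ltW//; near: n; exact: (cvgr_lt _ ez).
    - near=> n; apply/negbTE; rewrite -ltNge; near: n.
      exact: (cvgr_gt _ ez).
    - by rewrite dy eqxx in yd.
  near=> n; rewrite !indicE !itvE.
  have -> : (c < eps n * z + y)%R = (c < y)%R by near: n.
  by have -> : (eps n * z + y <= d)%R = (y <= d)%R by near: n.
- exact: integrable_normal_pdf.
- apply: aeW => z n _; rewrite lee_fin normrM (ger0_norm (normal_pdf_ge0 _ _ _)).
  by rewrite ler_piMl ?normal_pdf_ge0// indicE; case: (_ \in _); rewrite ?normr1 ?normr0.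
under [X in _ --> X -> _]eq_integral do rewrite EFinM.
rewrite integralZl//; last exact: integrable_normal_pdf.
by rewrite integral_normal_pdf mule1.
Unshelve. all: by end_near. Qed.

End smoothing.

(** * Recognizing a density on half-open intervals *)

Section density_measure.
Context {R : realType}.
Notation mu := (@lebesgue_measure R).
Variables (p : R -> R) (mp : measurable_fun setT p) (p0 : forall x, 0 <= p x).
Local Open Scope ereal_scope.

(* The two proof arguments are phantoms that let the measure structure be
   inferred from the term. *)
Definition density_measure of measurable_fun setT p & (forall x, (0 <= p x)%R) :=
  fun A : set (measurableTypeR R) => \int[mu]_(x in A) (p x)%:E.

Notation nu := (density_measure mp p0).

Let nu0 : nu set0 = 0.
Proof. by rewrite /density_measure integral_set0. Qed.

Let nu_ge0 A : 0 <= nu A.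
Proof. by apply: integral_ge0 => x _; rewrite lee_fin. Qed.

Let nu_sigma_additive : semi_sigma_additive nu.
Proof.
move=> A mA tA mUA; rewrite /density_measure ge0_integral_bigcup//; first last.
- by move=> x _; rewrite lee_fin.
- by apply/measurable_EFinP; apply: measurable_funTS.
apply: is_cvg_ereal_nneg_natsum_cond => n _ _.
by apply: integral_ge0 => x _; rewrite lee_fin.
Qed.

HB.instance Definition _ := isMeasure.Build _ _ _
  nu nu0 nu_ge0 nu_sigma_additive.

(** The law of [X] is the Stieltjes measure of its distribution function, and such a measure is
    determined by its values on half-open intervals. *)
Lemma is_density_itv d (T : measurableType d) (P : probability T R)
    (X : {RV P >-> R}) :
  (forall c e : R, P (X @^-1` `]c, e]) = \int[mu]_(x in `]c, e]) (p x)%:E) ->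
  is_density P X p.
Proof.
move=> h; split => // A mA.
have mX : @measurable_fun _ _ T (measurableTypeR R) setT X := measurable_funPT X.
(* The same function as [X], with its codomain retyped to the one on which [nu] and the Stieltjes
   measures live. *)
pose X' : {mfun T >-> measurableTypeR R} :=
  MeasurableFun.Pack (MeasurableFun.Class (isMeasurableFun.Build _ _ _ _ _ mX)).
pose D : probability (measurableTypeR R) R := distribution P X'.
rewrite -[LHS]/(D A) -(lebesgue_stieltjes_cdf_id D mA).
apply: (@lebesgue_stieltjes_measure_unique _ _ nu) => // _ [[c e] _ <-].
rewrite lebesgue_stieltjes_cdf_id//; exact: (h c e).
Qed.

End density_measure.

(** * Fourier inversion for an atomless variable *)

Section inversion_theorem.
Context d (T : measurableType d) (R : realType) (P : probability T R).
Notation mu := (@lebesgue_measure R).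
Variable X : {RV P >-> R}.

Let a t := complex.Re (charfun P X t).
Let b t := complex.Im (charfun P X t).

Hypotheses (ia : mu.-integrable setT (EFin \o a))
  (ib : mu.-integrable setT (EFin \o b))
  (X_no_atom : forall r, P (X @^-1` [set r]) = 0%E).

Let mcos (x : R) : measurable_fun setT (fun t : R => cos (t * x)).
Proof.
apply: measurableT_comp; last exact: measurable_funM.
by apply: continuous_measurable_fun; exact: continuous_cos.
Qed.

Let msin (x : R) : measurable_fun setT (fun t : R => sin (t * x)).
Proof.
apply: measurableT_comp; last exact: measurable_funM.
by apply: continuous_measurable_fun; exact: continuous_sin.
Qed.

Let ma : measurable_fun setT a. Proof. by have /measurable_int/measurable_EFinP := ia. Qed.
Let mb : measurable_fun setT b. Proof. by have /measurable_int/measurable_EFinP := ib. Qed.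

Let m t := `|a t| + `|b t|.

Lemma integrable_charfun_norm : mu.-integrable setT (EFin \o m).
Proof.
rewrite (_ : _ \o _ = ((EFin \o (fun t => `|a t|)%R) \+ (EFin \o (fun t => `|b t|)%R))%E)//.
by apply: integrableD => //; exact: integrable_norm.
Qed.

Lemma fourier_kernel_le x t : `|fourier_kernel X x t| <= `|a t| + `|b t|.
Proof.
apply: (le_trans (ler_normD _ _)).
by apply: lerD; rewrite normrM ler_piMr// (cos_max, sin_max).
Qed.

Lemma measurable_fourier_kernel x : measurable_fun setT (fourier_kernel X x).
Proof.
by apply: measurable_funD; apply: measurable_funM => //.
Qed.

Lemma integrable_fourier_kernel x : mu.-integrable setT (EFin \o fourier_kernel X x).
Proof.
apply: (le_integrable measurableT _ _ integrable_charfun_norm).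
  by apply/measurable_EFinP; exact: measurable_fourier_kernel.
move=> t _; rewrite lee_fin [leRHS]ger0_norm ?addr_ge0//.
exact: fourier_kernel_le.
Qed.

Definition fourier_density x := (2 * pi)^-1 * \int[mu]_t fourier_kernel X x t.

Let pi2_gt0 : 0 < 2 * pi :> R. Proof. by rewrite mulr_gt0// pi_gt0. Qed.

Lemma continuous_fourier_density : continuous fourier_density.
Proof.
move=> x; apply: cvgM; first exact: cvg_cst.
have := @continuity_under_integral R _ _ mu (fourier_kernel X)
  setT measurableT (x - 1) (x + 1) _ _ m integrable_charfun_norm _ x.
apply => //.
- by move=> y _; exact: integrable_fourier_kernel.
- apply: aeW => t _ y _; apply: cvgD; apply: cvgM; try exact: cvg_cst.
    apply: (cvg_comp (fun y => t * y) cos); last exact: continuous_cos.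
    by apply: cvgM; [exact: cvg_cst|exact: cvg_id].
  apply: (cvg_comp (fun y => t * y) sin); last exact: continuous_sin.
  by apply: cvgM; [exact: cvg_cst|exact: cvg_id].
- by move=> y _; apply: aeW => t _; exact: fourier_kernel_le.
- by rewrite inE/= in_itv/= ltrBlDr !ltrDl ltr01.
Qed.

Let mXpre (A : set R) : measurable A -> measurable (X @^-1` A).
Proof. by move=> mA; have := measurable_funPT X measurableT A mA; rewrite setTI. Qed.

(** The density of [X] plus an independent centred normal variable of standard deviation [eps n]. *)
Let q n x := \int[P]_w normal_pdf 0 (@eps R n) (x - X w).

Let qE n x : q n x = (2 * pi)^-1 * \int[mu]_t (gauss (@eps R n * t) * fourier_kernel X x t).
Proof.
by rewrite smoothed_inversion ?eps_gt0// mulKf// gt_eqF.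
Qed.

Let q_cvg x : q n x @[n --> \oo] --> fourier_density x.
Proof.
under eq_fun do rewrite qE.
apply: cvgM; first exact: cvg_cst.
have mk := measurable_fourier_kernel x.
have [|||||_ _ h] := @dominated_convergence _ _ _ mu setT measurableT
  (fun n t => (gauss (@eps R n * t) * fourier_kernel X x t)%:E)
  (EFin \o fourier_kernel X x) (EFin \o m).
- move=> n; apply/measurable_EFinP/measurable_funM => //.
  by apply: (measurableT_comp measurable_gauss); exact: measurable_funM.
- exact/measurable_EFinP.
- apply: aeW => t _; apply: cvg_EFin; first exact: nearW.
  rewrite -[X in _ --> X]mul1r; apply: cvgM; last exact: cvg_cst.
  have -> : 1 = @gauss R 0 by rewrite /gauss expr0n/= mul0r oppr0 expR0.
  apply: (cvg_comp (fun n => @eps R n * t) gauss); last exact: continuous_gauss.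
  by rewrite -(mul0r t); apply: cvgM; [exact: cvg_eps|exact: cvg_cst].
- exact: integrable_charfun_norm.
- apply: aeW => t n _; rewrite lee_fin normrM (ger0_norm (gauss_ge0 _)).
  apply: le_trans (fourier_kernel_le x t); rewrite ler_piMl//.
  by rewrite /gauss -expR0 ler_expR oppr_le0 divr_ge0// sqr_ge0.
apply: fine_cvg; rewrite fineK//.
by rewrite integrable_fin_num//; exact: integrable_fourier_kernel.
Qed.

Let q_ge0 n x : 0 <= q n x.
Proof. by apply: Rintegral_ge0 => w _; exact: normal_pdf_ge0. Qed.

(** The sign is not visible on the Fourier integral; it is inherited from the smoothed densities
    [q n], which converge to it. *)
Lemma fourier_density_ge0 x : 0 <= fourier_density x.
Proof.
have h := @q_cvg x.
rewrite -(cvg_lim _ h)//; apply: limr_ge; first by apply/cvg_ex; eexists; exact: h.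
by apply: nearW => n; exact: q_ge0.
Qed.

(** A bound for the smoothed densities that depends neither on the point nor on the width. *)
Let M := (2 * pi)^-1 * \int[mu]_t m t.

Let q_le n x : `|q n x| <= M.
Proof.
have ig : mu.-integrable setT (EFin \o (fun t => gauss (@eps R n * t) * fourier_kernel X x t)).
  apply: (le_integrable measurableT _ _ integrable_charfun_norm).
    apply/measurable_EFinP/measurable_funM; last exact: measurable_fourier_kernel.
    by apply: (measurableT_comp measurable_gauss); exact: measurable_funM.
  move=> t _; rewrite lee_fin normrM (ger0_norm (gauss_ge0 _)) [leRHS]ger0_norm ?addr_ge0//.
  apply: le_trans (fourier_kernel_le x t); rewrite ler_piMl//.
  by rewrite /gauss -expR0 ler_expR oppr_le0 divr_ge0// sqr_ge0.
have c0 : 0 <= (2 * pi)^-1 :> R by rewrite invr_ge0 ltW.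
rewrite qE normrM (ger0_norm c0) /M; apply: ler_wpM2l => //.
apply: le_trans (le_normr_Rintegral measurableT ig) _.
apply: le_Rintegral => //.
- exact: integrable_norm.
- exact: integrable_charfun_norm.
move=> t _; rewrite normrM (ger0_norm (gauss_ge0 _)).
apply: le_trans (fourier_kernel_le x t); rewrite ler_piMl//.
by rewrite /gauss -expR0 ler_expR oppr_le0 divr_ge0// sqr_ge0.
Qed.

Let measurable_q n : measurable_fun setT (q n).
Proof.
pose F (z : R * T) := (normal_pdf 0 (@eps R n) (z.1 - X z.2))%:E.
have mF : measurable_fun setT F.
  apply/measurable_EFinP; apply: (measurableT_comp (measurable_normal_pdf _ _)).
  by apply: measurable_funB => //; exact: measurableT_comp.
have F0 z : (0 <= F z)%E by rewrite lee_fin normal_pdf_ge0.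
have := measurable_fun_fubini_tonelli_F (m2 := P) F mF F0.
by move=> h; apply: (measurableT_comp _ h).
Qed.

Let EFin_q n x : (q n x)%:E = (\int[P]_w (normal_pdf 0 (@eps R n) (x - X w))%:E)%E.
Proof.
rewrite EFin_Rintegral//.
apply: (@le_integrable _ _ _ _ _ measurableT _ (EFin \o cst (normal_peak (@eps R n)))).
- apply/measurable_EFinP; apply: measurableT_comp; last exact: measurable_funB.
  exact: measurable_normal_pdf.
- move=> w _; rewrite /= lee_fin !ger0_norm ?normal_pdf_ge0 ?normal_peak_ge0//.
  by rewrite normal_pdf_ub ?gt_eqF ?eps_gt0.
- exact: finite_measure_integrable_cst.
Qed.

Let integral_q (A : set R) n : measurable A ->
  (\int[mu]_(x in A) (q n x)%:E =
   \int[P]_w \int[mu]_x (\1_A x * normal_pdf 0 (@eps R n) (x - X w))%:E)%E.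
Proof.
move=> mA.
pose F (z : R * T) := (\1_A z.1 * normal_pdf 0 (@eps R n) (z.1 - X z.2))%:E.
have mF : measurable_fun setT F.
  apply/measurable_EFinP; apply: measurable_funM.
    exact: (measurableT_comp (measurable_indic mA)).
  apply: (measurableT_comp (measurable_normal_pdf _ _)).
  by apply: measurable_funB => //; exact: measurableT_comp.
have F0 z : (0 <= F z)%E by rewrite lee_fin mulr_ge0// normal_pdf_ge0.
rewrite -(fubini_tonelli (m1 := mu) (m2 := P) F mF F0) integral_indicM.
apply: eq_integral => x _; rewrite EFinM EFin_q -ge0_integralZl_EFin//.
- by move=> w _; rewrite lee_fin normal_pdf_ge0.
- apply/measurable_EFinP; apply: measurableT_comp; last exact: measurable_funB.
  exact: measurable_normal_pdf.
Qed.

Lemma measurable_fourier_density : measurable_fun setT fourier_density.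
Proof.
by apply: continuous_measurable_fun; exact: continuous_fourier_density.
Qed.

Lemma inversion_itv (c e : R) : (P (X @^-1` `]c, e]) =
  \int[mu]_(x in `]c, e]) (fourier_density x)%:E)%E.
Proof.
set A : set R := `]c, e]%classic.
have mA : measurable A by exact: measurable_itv.
(* Two limits of the same integrals are compared. The first uses the uniform bound [M], integrable
   over the bounded interval. *)
have h1 : (\int[mu]_(x in A) (q n x)%:E @[n --> \oo] -->
    \int[mu]_(x in A) (fourier_density x)%:E)%E.
  have [|||||_ _ h] := @dominated_convergence _ _ _ mu A mA
    (fun n x => (q n x)%:E) (EFin \o fourier_density) (cst M%:E).
  - by move=> n; apply/measurable_EFinP; apply: measurable_funTS; exact: measurable_q.
  - by apply/measurable_EFinP; apply: measurable_funTS; exact: measurable_fourier_density.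
  - by apply: aeW => x _; apply: cvg_EFin; [exact: nearW|exact: q_cvg].
  - apply/integrableP; split=> //.
    have muA : (mu A < +oo)%E.
      by rewrite lebesgue_measure_itv/=; case: ifPn => _; rewrite ?ltry// -EFinD ltry.
    by rewrite integral_cst//; apply: lte_mul_pinfty.
  - by apply: aeW => x n _; rewrite lee_fin q_le.
  - exact: h.
(* By Tonelli these integrals are also expectations of the smoothed indicator evaluated at [X]. *)
have h2 : (\int[mu]_(x in A) (q n x)%:E @[n --> \oo] --> P (X @^-1` A))%E.
  under eq_fun do rewrite integral_q//.
  have -> : P (X @^-1` A) = (\int[P]_w (\1_A (X w))%:E)%E.
    rewrite (_ : (fun w => _) = (fun w => (\1_(X @^-1` A) w)%:E))//.
    by rewrite integral_indic ?setIT//; exact: mXpre.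
  have [|||||_ _ h] := @dominated_convergence _ _ _ P setT measurableT
    (fun n w => \int[mu]_x (\1_A x * normal_pdf 0 (@eps R n) (x - X w))%:E)%E
    (fun w => (\1_A (X w))%:E) (cst 1%E).
  - move=> n; pose F (z : R * T) := (\1_A z.1 * normal_pdf 0 (@eps R n) (z.1 - X z.2))%:E.
    have mF : measurable_fun setT F.
      apply/measurable_EFinP; apply: measurable_funM.
        exact: (measurableT_comp (measurable_indic mA)).
      apply: (measurableT_comp (measurable_normal_pdf _ _)).
      by apply: measurable_funB => //; exact: measurableT_comp.
    have F0 z : (0 <= F z)%E by rewrite lee_fin mulr_ge0// normal_pdf_ge0.
    exact: (measurable_fun_fubini_tonelli_G (m1 := mu) F mF F0).
  - by apply/measurable_EFinP; apply: (measurableT_comp (measurable_indic mA)).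
  (* The smoothed indicator is only known to converge to the indicator off the endpoints, so the
     exceptional event is that [X] hits one of them; it is null because [X] has no atoms. *)
  - exists (X @^-1` [set c] `|` X @^-1` [set e]); split.
    + by apply: measurableU; apply: mXpre; exact: measurable_set1.
    + by apply: null_set_setU; try exact: X_no_atom; apply: mXpre; exact: measurable_set1.
    + move=> w /= h; apply: contrapT => /not_orP[wc we]; apply: h => _.
      by apply: cvg_smoothed_indic; apply/eqP.
  - exact: finite_measure_integrable_cst.
  - apply: aeW => w n _; rewrite gee0_abs; last first.
      by apply: integral_ge0 => x _; rewrite lee_fin mulr_ge0// normal_pdf_ge0.
    rewrite integral_normal_pdf_affine ?eps_gt0// -(@integral_normal_pdf R 0 1).
    have mN := @measurable_normal_pdf R 0 1.
    apply: ge0_le_integral => //.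
    + by move=> z _; rewrite lee_fin mulr_ge0// normal_pdf_ge0.
    + apply/measurable_EFinP/measurable_funM => //.
      by apply: (measurableT_comp (measurable_indic mA)); exact: measurable_affine.
    + exact/measurable_EFinP.
    + by move=> z _; rewrite lee_fin ler_piMl ?normal_pdf_ge0.
  - exact: h.
rewrite -(cvg_lim _ h1)//; apply/esym; exact: cvg_lim h2.
Qed.

Lemma fourier_density_is_density : is_density P X fourier_density.
Proof.
exact: (is_density_itv measurable_fourier_density fourier_density_ge0 inversion_itv).
Qed.

End inversion_theorem.

(** * Densities of the sums and the local limit theorem *)

Section affine_preimage.
Context {R : realType}.
Notation mu := (@lebesgue_measure R).
Local Open Scope ereal_scope.

(** The rule for densities: if Y has density f, then (Y - b) / c has density c f(c x + b). It is
    used for the unit shifts, with c = 1, and for the normalization, with b = 0. *)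
Lemma integral_affine_preimage (c b : R) (A : set R) (f : R -> R) : (0 < c)%R ->
  measurable A -> measurable_fun setT f -> (forall x, 0 <= f x)%R ->
  \int[mu]_(y in (fun y => (y - b) / c)%R @^-1` A) (f y)%:E =
  \int[mu]_(x in A) (c * f (c * x + b))%:E.
Proof.
move=> c0 mA mf f0; set B := _ @^-1` A.
have mB : measurable B.
  have mg : measurable_fun setT (fun y : R => (y - b) / c)%R.
    by apply: measurable_funM => //; exact: measurable_funB.
  by have := mg measurableT A mA; rewrite setTI.
have BE x : \1_B (c * x + b)%R = \1_A x :> R.
  rewrite !indicE; congr (nat_of_bool _)%:R.
  have e : ((c * x + b - b) / c = x)%R by field; rewrite gt_eqF.
  by apply/idP/idP; rewrite !inE /B/= e.
rewrite (integral_indicM B f) (integral_indicM A (fun x => c * f (c * x + b))%R).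
rewrite (@ge0_integral_affine _ c b)//; last 2 first.
- by apply/measurable_EFinP/measurable_funM => //; exact: measurable_indic.
- by move=> x; rewrite lee_fin mulr_ge0.
rewrite -ge0_integralZl_EFin//; last 3 first.
- by move=> z _; rewrite lee_fin mulr_ge0.
- apply/measurable_EFinP/measurable_funM.
    by apply: (measurableT_comp (measurable_indic mB)); exact: measurable_affine.
  by apply: measurableT_comp => //; exact: measurable_affine.
- exact: ltW.
by apply: eq_integral => x _; rewrite -EFinM BE mulrCA.
Qed.

End affine_preimage.

(** * Densities of the sums, by conditioning on the last step *)

Section bernoulli_sums.
Context d (T : measurableType d) (R : realType) (P : probability T R).
Notation mu := (@lebesgue_measure R).
Variables (X : {RV P >-> R}) (Xs : nat -> {RV P >-> R}) (g : R -> R).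
Hypotheses (mg : measurable_fun setT g) (g0 : forall x, 0 <= g x)
  (gX : forall A : set R, measurable A ->
     P (X @^-1` A) = (\int[mu]_(x in A) (g x)%:E)%E)
  (Xs_bernoulli : forall n : nat, (0 < n)%N -> sym_bernoulli P (Xs n))
  (indep : mutually_independent (with_initial X Xs)).

(** A symmetric step averages the two unit translates of the previous density. *)
Fixpoint walk_density (n : nat) (x : R) : R :=
  if n is n'.+1 then (walk_density n' (x - 1) + walk_density n' (x + 1)) / 2
  else g x.

Lemma measurable_walk_density n : measurable_fun setT (walk_density n).
Proof.
elim: n => [//|n IH] /=; apply: measurable_funM => //; apply: measurable_funD.
  by apply: measurableT_comp => //; exact: measurable_funB.
by apply: measurableT_comp => //; exact: measurable_funD.
Qed.

Lemma walk_density_ge0 n x : 0 <= walk_density n x.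
Proof. by elim: n x => [//|n IH] x /=; rewrite divr_ge0// addr_ge0. Qed.

Definition walk n w := X w + \sum_(1 <= k < n.+1) Xs k w.

Lemma walkS n w : walk n.+1 w = walk n w + Xs n.+1 w.
Proof. by rewrite /walk big_nat_recr//= addrA. Qed.

Lemma measurable_walk n : measurable_fun setT (walk n).
Proof.
elim: n => [|n IH].
  have -> // : walk 0 = X.
  by apply/funext => w; rewrite /walk big_geq// addr0.
have -> : walk n.+1 = (fun w => walk n w + Xs n.+1 w).
  by apply/funext => w; exact: walkS.
exact: measurable_funD.
Qed.

Let measurable_walk_pre n (A : set R) : measurable A -> measurable (walk n @^-1` A).
Proof. by move=> mA; have := @measurable_walk n measurableT A mA; rewrite setTI. Qed.

Let measurable_pre (Y : {RV P >-> R}) (A : set R) : measurable A -> measurable (Y @^-1` A).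
Proof. by move=> mA; have := measurable_funPT Y measurableT A mA; rewrite setTI. Qed.

Let shift_density n (s : R) (A : set R) : measurable A ->
  (\int[mu]_(y in [set y | A (y + s)%R]) (walk_density n y)%:E =
   \int[mu]_(x in A) (walk_density n (x - s)%R)%:E)%E.
Proof.
move=> mA.
have := @integral_affine_preimage R 1 (- s) A (walk_density n) ltr01 mA
  (@measurable_walk_density n) (@walk_density_ge0 n).
under [X in _ = X -> _]eq_integral do rewrite !mul1r.
move=> <-; congr (integral _ _ _); apply/funext => y /=.
by rewrite opprK divr1.
Qed.

Let walk_densityS n (A : set R) : measurable A ->
  (\int[mu]_(x in A) (walk_density n.+1 x)%:E =
   (2^-1)%:E * \int[mu]_(y in [set y | A (y + 1)%R]) (walk_density n y)%:E +
   (2^-1)%:E * \int[mu]_(y in [set y | A (y - 1)%R]) (walk_density n y)%:E)%E.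
Proof.
move=> mA; rewrite shift_density// (shift_density _ (-1))//.
have ms (s : R) : measurable_fun A (fun x => (walk_density n (x - s))%:E).
  apply/measurable_EFinP/measurable_funTS.
  by apply: (measurableT_comp (@measurable_walk_density n)); exact: measurable_funB.
have s0 (s x : R) : A x -> (0 <= (walk_density n (x - s)%R)%:E)%E.
  by rewrite lee_fin walk_density_ge0.
rewrite -muleDr ?ge0_adde_def ?inE ?integral_ge0// -?ge0_integralD//.
- rewrite -ge0_integralZl_EFin//.
  + by apply: eq_integral => x _; rewrite opprK /= -EFinD -EFinM mulrC.
  + by move=> x Ax; rewrite adde_ge0// s0.
  + exact: (emeasurable_funD (ms 1) (ms (- 1))).
- exact: s0.
- exact: ms.
- exact: s0.
- exact: ms.
- exact: s0.
- exact: s0.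
Qed.

(* Carrying along the events of the steps beyond [n] makes the induction on the
   set-wise product rule go through. *)
Lemma walk_prob n (J : seq nat) (B : nat -> set R) (A : set R) :
  uniq J -> (forall i, i \in J -> (n < i)%N) ->
  (forall i, measurable (B i)) -> measurable A ->
  P (walk n @^-1` A `&` \big[setI/setT]_(i <- J) (Xs i @^-1` B i)) =
  (\int[mu]_(x in A) (walk_density n x)%:E * \prod_(i <- J) P (Xs i @^-1` B i))%E.
Proof.
elim: n J B A => [|n IH] J B A uJ Jn mB mA.
  (* Index 0 of [with_initial] stands for [X], so the event on [X] becomes the event of index 0. *)
  pose B' i := if i is 0%N then A else B i.
  have J0 : 0%N \notin J by apply/negP => /Jn.
  have := @indep (0%N :: J) B'; rewrite /= J0 uJ => /(_ isT).
  rewrite !big_cons/=.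
  have -> : \big[setI/setT]_(j <- J) (with_initial X Xs j @^-1` B' j) =
      \big[setI/setT]_(j <- J) (Xs j @^-1` B j).
    by rewrite !big_seq; apply: eq_bigr => -[|i] // /Jn.
  have -> : (\prod_(j <- J) P (with_initial X Xs j @^-1` B' j) =
      \prod_(j <- J) P (Xs j @^-1` B j))%E.
    by rewrite !big_seq; apply: eq_bigr => -[|i] // /Jn.
  have mB' i : i \in 0%N :: J -> measurable (B' i) by case: i => [|i] _; [exact: mA|exact: mB].
  move=> /(_ mB') h; rewrite -gX// -h.
  by congr (P (_ `&` _)); apply/funext => w; rewrite /walk/= big_geq// addr0.
pose E := \big[setI/setT]_(i <- J) (Xs i @^-1` B i).
have mE : measurable E by apply: bigsetI_measurable => i _; exact: measurable_pre.
pose F (s : R) := Xs n.+1 @^-1` [set s].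
have mF s : measurable (F s) by apply: measurable_pre; exact: measurable_set1.
have [] := Xs_bernoulli (ltn0Sn n); rewrite -/(F 1) -/(F (- 1)) => F1 FN1.
have Jn1 : n.+1 \notin J by apply/negP => /Jn; rewrite ltnn.
(* On the event that step n + 1 equals [s], the walk condition becomes one on [walk n]; that event
   joins the list of later steps, and the induction hypothesis applies to the longer list. *)
have step (s : R) : P (walk n.+1 @^-1` A `&` E `&` F s) =
    (\int[mu]_(x in [set y | A (y + s)%R]) (walk_density n x)%:E *
      (P (F s) * \prod_(i <- J) P (Xs i @^-1` B i)))%E.
  pose B' i := if i == n.+1 then [set s] else B i.
  have -> : walk n.+1 @^-1` A `&` E `&` F s =
      walk n @^-1` [set y | A (y + s)%R] `&` \big[setI/setT]_(i <- n.+1 :: J) (Xs i @^-1` B' i).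
    rewrite big_cons {1}/B' eqxx.
    have -> : \big[setI/setT]_(i <- J) (Xs i @^-1` B' i) = E.
      rewrite /E !big_seq; apply: eq_bigr => i iJ; rewrite /B'.
      by case: eqP => // ie; move: Jn1; rewrite -ie iJ.
    rewrite (setIC (F s)) setICA !setIA (setIC _ E) -!setIA; congr (_ `&` _).
    apply/seteqP; split=> w [/= h hs]; split => //; move: h.
      by rewrite walkS hs.
    by rewrite /= walkS hs.
  rewrite IH.
  - rewrite big_cons {1}/B' eqxx; congr (_ * (_ * _))%E.
    rewrite !big_seq; apply: eq_bigr => i iJ; rewrite /B'.
    by case: eqP => // ie; move: Jn1; rewrite -ie iJ.
  - by rewrite /= Jn1.
  - by move=> i; rewrite inE => /orP[/eqP ->|/Jn/ltnW].
  - by move=> i; rewrite /B'; case: ifP => // _; exact: measurable_set1.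
  - have ms : measurable_fun setT (fun y : R => y + s) by exact: measurable_funD.
    by have := ms measurableT A mA; rewrite setTI.
have dF : F 1 `&` F (- 1) = set0.
  apply/seteqP; split=> // w [/=]; rewrite /F/= => -> /eqP.
  by rewrite -subr_eq0 opprK (_ : 1 + 1 = 2%:R) ?pnatr_eq0.
have FU : P (~` (F 1 `|` F (- 1))) = 0%E.
  rewrite probability_setC; last exact: measurableU.
  have -> : P (F 1 `|` F (- 1)) = (2^-1 + 2^-1)%:E.
    by rewrite EFinD -{1}F1 -FN1; exact: measureU.
  by rewrite -EFinB; congr EFin; field.
have mB' : measurable (walk n.+1 @^-1` A `&` E).
  by apply: measurableI => //; exact: measurable_walk_pre.
(* The values 1 and -1 exhaust the probability by [FU], so every event splits along them up to a
   null set. *)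
have split (B' : set T) : measurable B' -> P B' = (P (B' `&` F 1%R) + P (B' `&` F (- 1)%R))%E.
  move=> mB0; have mFU := measurableU _ _ (mF 1) (mF (- 1)).
  transitivity (P (B' `&` (F 1 `|` F (- 1)))).
    rewrite (measureDI P mB0 mFU) [X in (X + _)%E](_ : _ = 0%E) ?add0e//.
    apply/eqP; rewrite eq_le measure_ge0 andbT -FU le_measure ?inE//.
    - exact: measurableD.
    - exact: measurableC.
  rewrite setIUr; apply: measureU; try exact: measurableI.
  by rewrite setIACA setIid dF setI0.
rewrite split// !step walk_densityS// F1 FN1 !muleA -ge0_muleDl.
- by rewrite (muleC _ (2^-1)%:E) (muleC _ (2^-1)%:E).
- by rewrite mule_ge0 ?lee_fin//; apply: integral_ge0 => x _; rewrite lee_fin walk_density_ge0.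
- by rewrite mule_ge0 ?lee_fin//; apply: integral_ge0 => x _; rewrite lee_fin walk_density_ge0.
Qed.

Lemma walk_is_density n (A : set R) : measurable A ->
  P (walk n @^-1` A) = (\int[mu]_(x in A) (walk_density n x)%:E)%E.
Proof.
move=> mA; have := @walk_prob n [::] (fun=> setT) A isT.
by rewrite !big_nil setIT mule1; apply.
Qed.

Definition normalized_density n x : R :=
  Num.sqrt n%:R * walk_density n (Num.sqrt n%:R * x).

Lemma normalized_is_density n : (0 < n)%N ->
  is_density P (normalized_sum X Xs n) (normalized_density n).
Proof.
move=> n0; have n0' : 0 < Num.sqrt n%:R :> R by rewrite sqrtr_gt0 ltr0n.
split.
- apply: measurable_funM => //; apply: (measurableT_comp (@measurable_walk_density n)).
  exact: measurable_funM.
- by move=> x; rewrite mulr_ge0 ?walk_density_ge0// ltW.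
- move=> A mA.
  have := integral_affine_preimage 0 n0' mA (@measurable_walk_density n) (@walk_density_ge0 n).
  under [X in _ = X -> _]eq_integral do rewrite addr0.
  move=> <-; rewrite -walk_is_density.
    by congr (P _); apply/funext => w /=; rewrite subr0.
  have ms : measurable_fun setT (fun y : R => (y - 0) / Num.sqrt n%:R).
    by apply: measurable_funM => //; exact: measurable_funB.
  by have := ms measurableT A mA; rewrite setTI.
Qed.

End bernoulli_sums.

(** * Fourier form of the densities and uniform distance to the normal density *)

Section local_limit.
Context d (T : measurableType d) (R : realType) (P : probability T R).
Notation mu := (@lebesgue_measure R).
Variables (X : {RV P >-> R}).

Let a t := complex.Re (charfun P X t).
Let b t := complex.Im (charfun P X t).

Hypotheses (ia : mu.-integrable setT (EFin \o a))
  (ib : mu.-integrable setT (EFin \o b)).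

Let g := fourier_density X.

Let pi2_gt0 : 0 < 2 * pi :> R. Proof. by rewrite mulr_gt0// pi_gt0. Qed.

Let mcosn n : measurable_fun setT (fun t : R => cos t ^+ n).
Proof.
apply: measurable_funX; apply: continuous_measurable_fun; exact: continuous_cos.
Qed.

Lemma integrable_cos_kernel n x :
  mu.-integrable setT (EFin \o (fun t => cos t ^+ n * fourier_kernel X x t)).
Proof.
apply: (le_integrable measurableT _ _ (integrable_fourier_kernel ia ib x)).
  apply/measurable_EFinP/measurable_funM; first exact: mcosn.
  by have /measurable_int/measurable_EFinP := integrable_fourier_kernel ia ib x.
move=> t _; rewrite lee_fin normrM ler_piMl// normrX exprn_ile1//; exact: cos_max.
Qed.

(** Averaging over the unit shifts multiplies by cos t, the characteristic function of one step;
    [walk_density_fourier] iterates this to get the n-th power. *)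
Lemma fourier_kernel_shift x t :
  fourier_kernel X (x - 1) t + fourier_kernel X (x + 1) t = 2 * cos t * fourier_kernel X x t.
Proof.
rewrite /fourier_kernel !mulrDr mulrN mulr1 cosB sinB cosD sinD; ring.
Qed.

Lemma walk_density_fourier n x : walk_density g n x =
  (2 * pi)^-1 * \int[mu]_t (cos t ^+ n * fourier_kernel X x t).
Proof.
elim: n x => [|n IH] x /=.
  by rewrite /g /fourier_density; congr (_ * _); apply: eq_Rintegral => t _; rewrite expr0 mul1r.
rewrite !IH -mulrDr -RintegralD//; try exact: integrable_cos_kernel.
rewrite -mulrA (mulrC _ 2^-1); congr (_ * _).
rewrite -RintegralZl//.
  apply: eq_Rintegral => t _; rewrite -mulrDr fourier_kernel_shift exprS.
  by field.
rewrite (_ : _ \o _ = ((EFin \o (fun t => cos t ^+ n * fourier_kernel X (x - 1) t)%R) \+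
   (EFin \o (fun t => cos t ^+ n * fourier_kernel X (x + 1) t)%R))%E)//.
by apply: integrableD => //; exact: integrable_cos_kernel.
Qed.

Lemma integrable_scaled_kernel n x : (0 < n)%N ->
  mu.-integrable setT (fun s => (cos (s / Num.sqrt n%:R) ^+ n *
    (a (s / Num.sqrt n%:R) * cos (s * x) + b (s / Num.sqrt n%:R) * sin (s * x)))%:E).
Proof.
move=> n0; have n0' : 0 < Num.sqrt n%:R :> R by rewrite sqrtr_gt0 ltr0n.
have c0 : 0 < (Num.sqrt n%:R)^-1 :> R by rewrite invr_gt0.
apply: eq_integrable (integrable_affine 0 c0 (integrable_cos_kernel n (Num.sqrt n%:R * x))) => //.
move=> s _; rewrite /= addr0 (mulrC _^-1) /fourier_kernel.
by rewrite (_ : s / Num.sqrt n%:R * (Num.sqrt n%:R * x) = s * x)//; field; rewrite gt_eqF.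
Qed.

Lemma normalized_density_fourier n x : (0 < n)%N -> normalized_density g n x =
  (2 * pi)^-1 * \int[mu]_s (cos (s / Num.sqrt n%:R) ^+ n *
    (a (s / Num.sqrt n%:R) * cos (s * x) + b (s / Num.sqrt n%:R) * sin (s * x))).
Proof.
move=> n0; have n0' : 0 < Num.sqrt n%:R :> R by rewrite sqrtr_gt0 ltr0n.
rewrite /normalized_density walk_density_fourier mulrCA; congr (_ * _).
rewrite (@Rintegral_affine _ (Num.sqrt n%:R)^-1 0 _ _ (integrable_cos_kernel _ _)) ?invr_gt0//.
rewrite mulrA divff ?gt_eqF// mul1r; apply: eq_Rintegral => s _.
rewrite addr0 (mulrC _^-1) /fourier_kernel.
by rewrite (_ : s / Num.sqrt n%:R * (Num.sqrt n%:R * x) = s * x)//; field; rewrite gt_eqF.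
Qed.

Lemma std_normal_pdf_fourier x : std_normal_pdf x =
  (2 * pi)^-1 * \int[mu]_s (gauss s * cos (s * x)).
Proof.
have e : Num.sqrt (2 * pi) ^+ 2 = 2 * pi :> R.
  by rewrite sqr_sqrtr// mulr_ge0// pi_ge0.
rewrite gauss_fourier /std_normal_pdf normal_pdfE_gauss// divr1 mulr1 -{2}e.
by field; rewrite gt_eqF// sqrt2pi_gt0.
Qed.

Let D (h : R -> R) n := (\int[mu]_s `|cos (s / Num.sqrt n%:R) ^+ n * h (s / Num.sqrt n%:R) -
    gauss s * h 0|%R%:E)%E.

Lemma normalized_density_dist n x : (0 < n)%N ->
  ((`|normalized_density g n x - std_normal_pdf x|)%:E <=
   ((2 * pi)^-1)%:E * (D a n + D b n))%E.
Proof.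
move=> n0; have n0' : 0 < Num.sqrt n%:R :> R by rewrite sqrtr_gt0 ltr0n.
pose c : R := Num.sqrt n%:R.
(* The difference of integrands splits as [u] + [v]: the values f(0) = 1, real, turn [a 0] and [b 0]
   into 1 and 0, so exactly one Gaussian term is subtracted. The trigonometric factors are at most 1
   in absolute value, which makes the bound independent of [x]. *)
pose u s := (cos (s / c) ^+ n * a (s / c) - gauss s * a 0) * cos (s * x).
pose v s := (cos (s / c) ^+ n * b (s / c) - gauss s * b 0) * sin (s * x).
have ma : measurable_fun setT a by have /measurable_int/measurable_EFinP := ia.
have mb : measurable_fun setT b by have /measurable_int/measurable_EFinP := ib.
have mdiv : measurable_fun setT (fun s : R => s / c) by exact: measurable_funM.
have mxa (h : R -> R) : measurable_fun setT h ->
    measurable_fun setT (fun s : R => cos (s / c) ^+ n * h (s / c) - gauss s * h 0).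
  move=> mh; apply: measurable_funB.
    apply: measurable_funM; first exact: measurable_cos_pow.
    exact: (measurableT_comp mh).
  by apply: measurable_funM => //; exact: measurable_gauss.
have mc : measurable_fun setT (fun s : R => cos (s * x)).
  apply: measurableT_comp; last exact: measurable_funM.
  by apply: continuous_measurable_fun; exact: continuous_cos.
have ms : measurable_fun setT (fun s : R => sin (s * x)).
  apply: measurableT_comp; last exact: measurable_funM.
  by apply: continuous_measurable_fun; exact: continuous_sin.
have mu' : measurable_fun setT u by apply: measurable_funM => //; exact: mxa.
have mv' : measurable_fun setT v by apply: measurable_funM => //; exact: mxa.
have igc : mu.-integrable setT (EFin \o (fun s => gauss s * cos (s * x))).
  by apply: integrable_bounded_gauss => // s; exact: cos_max.
have E : normalized_density g n x - std_normal_pdf x = (2 * pi)^-1 * \int[mu]_s (u s + v s).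
  rewrite normalized_density_fourier// std_normal_pdf_fourier -mulrBr -RintegralB//.
  - congr (_ * _); apply: eq_Rintegral => s _; rewrite /u /v /a /b Re_charfun0 Im_charfun0; ring.
  - exact: integrable_scaled_kernel.
have i : mu.-integrable setT (EFin \o (fun s => u s + v s)).
  rewrite (_ : _ \o _ = ((fun s => (cos (s / c) ^+ n * (a (s / c) * cos (s * x) +
      b (s / c) * sin (s * x)))%:E) \- (fun s => (gauss s * cos (s * x))%:E))%E); last first.
    apply/funext => s /=; rewrite -EFinB; congr EFin.
    by rewrite /u /v /a /b Re_charfun0 Im_charfun0; ring.
  exact: (integrableB measurableT (integrable_scaled_kernel x n0) igc).
have pi0 : 0 <= (2 * pi)^-1 :> R by rewrite invr_ge0 ltW.
rewrite E normrM (ger0_norm pi0) EFinM lee_wpmul2l ?lee_fin//.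
rewrite EFin_normr_Rintegral//.
apply: (le_trans (le_abse_integral _ measurableT _)).
  by apply/measurable_EFinP; exact: measurable_funD.
have mD (h : R -> R) : measurable_fun setT h -> measurable_fun setT
    (fun s : R => `|cos (s / c) ^+ n * h (s / c) - gauss s * h 0|%:E).
  by move=> mh; apply/measurable_EFinP; apply: measurableT_comp => //; exact: mxa.
rewrite /D -ge0_integralD//; [|exact: mD|exact: mD].
apply: ge0_le_integral => //.
- by apply: measurableT_comp => //; apply/measurable_EFinP; exact: measurable_funD.
- by apply: emeasurable_funD; exact: mD.
- move=> s _; rewrite -EFinD lee_fin; apply: (le_trans (ler_normD _ _)).
  by apply: lerD; rewrite normrM ler_piMr// (cos_max, sin_max).
Qed.

End local_limit.

Lemma continuous_walk_density {R : realType} (g : R -> R) n :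
  continuous g -> continuous (walk_density g n).
Proof.
move=> cg; have shift (s : R) : continuous (fun y : R => y + s).
  by move=> x; apply: cvgD; [exact: cvg_id|exact: cvg_cst].
elim: n => [//|n IH] x /=; apply: cvgMl; apply: cvgD.
  exact: (cvg_comp _ _ (shift (-1) x) (IH _)).
exact: (cvg_comp _ _ (shift 1 x) (IH _)).
Qed.

Lemma continuous_normalized_density {R : realType} (g : R -> R) n :
  continuous g -> continuous (normalized_density g n).
Proof.
move=> cg x; apply: cvgMr.
have scale : continuous (fun y : R => Num.sqrt n%:R * y).
  by move=> y; apply: cvgMr; exact: cvg_id.
exact: (cvg_comp _ _ (scale x) (@continuous_walk_density _ g n cg _)).
Qed.

Lemma density_no_atom d (T : measurableType d) (R : realType) (P : probability T R)
    (X : T -> R) (g : R -> R) : is_density P X g -> forall r, P (X @^-1` [set r]) = 0%E.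
Proof.
by move=> [mg g0 gX] r; rewrite gX// integral_set1.
Qed.

Theorem theorem1p2 (d : measure_display) (T : measurableType d) (R : realType)
    (P : probability T R) (X : {RV P >-> R}) (Xs : nat -> {RV P >-> R})
    (X_density : exists g : R -> R, is_density P X g)
    (Xs_bernoulli : forall n : nat, (0 < n)%N -> sym_bernoulli P (Xs n))
    (indep : mutually_independent (with_initial X Xs))
    (f_zeros : forall k : int, k != 0 -> charfun P X (pi * k%:~R) = 0)
    (X_moment : ('E_P[fun w => `|X w|%R] < +oo)%E)
    (f'_integrable : cintegrable (cderive1 (charfun P X))) :
  exists p : nat -> R -> R,
    (forall n : nat, (0 < n)%N ->
       continuous (p n) /\ is_density P (normalized_sum X Xs n) (p n)) /\
    (fun n : nat =>
       ereal_sup [set (`|p n x - std_normal_pdf x|)%:E | x in [set: R]])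
      @ \oo --> 0%E.
Proof.
have [g0 dg0] := X_density; have X_no_atom := density_no_atom dg0.
have X1 : P.-integrable setT (EFin \o X).
  apply/integrableP; split; first exact/measurable_EFinP.
  by move: X_moment; rewrite unlock.
pose mu := @lebesgue_measure R.
pose a t := complex.Re (charfun P X t); pose b t := complex.Im (charfun P X t).
have [ia' ib'] := f'_integrable.
have [da ca] := Re_charfun_C1 X1; have [db cb] := Im_charfun_C1 X1.
have f_zero (k : nat) : charfun P X (pi * k.+1%:R) = 0.
  by rewrite pmulrn f_zeros.
have f_zeroN (k : nat) : charfun P X (- (pi * k.+1%:R)) = 0.
  by rewrite -mulrN pmulrn -mulrNz f_zeros.
have a0 k : a (pi * k.+1%:R) = 0 by rewrite /a f_zero.
have a0N k : a (- (pi * k.+1%:R)) = 0 by rewrite /a f_zeroN.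
have b0 k : b (pi * k.+1%:R) = 0 by rewrite /b f_zero.
have b0N k : b (- (pi * k.+1%:R)) = 0 by rewrite /b f_zeroN.
have ia : mu.-integrable setT (EFin \o a) by exact: integrable_of_derive1 da ca ia' a0 a0N.
have ib : mu.-integrable setT (EFin \o b) by exact: integrable_of_derive1 db cb ib' b0 b0N.
have Da := cvg_cos_pow_integral da ca ia' a0 a0N.
have Db := cvg_cos_pow_integral db cb ib' b0 b0N.
have cg := continuous_fourier_density ia ib.
have [mg ge0 gX] := fourier_density_is_density ia ib X_no_atom.
(* The witnesses are built from the continuous density of [X] given by inversion rather than from
   the assumed one, which may be discontinuous. *)
exists (normalized_density (fourier_density X)); split=> [n n0|].
  split; first exact: continuous_normalized_density.
  exact: normalized_is_density.
pose bound n := (((2 * pi)^-1)%:E * (\int[mu]_s `|cos (s / Num.sqrt n%:R) ^+ n *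
    a (s / Num.sqrt n%:R) - gauss s * a 0|%:E + \int[mu]_s `|cos (s / Num.sqrt n%:R) ^+ n *
    b (s / Num.sqrt n%:R) - gauss s * b 0|%:E))%E.
have bound_cvg : bound n @[n --> \oo] --> 0%E.
  rewrite -[0%E](mule0 ((2 * pi)^-1)%:E) -[0%E in X in _ --> X]adde0.
  apply: cvgeZl => //; exact: (cvgeD _ Da Db).
apply: (squeeze_cvge _ (cvg_cst 0%E) bound_cvg).
near=> n.
have n0 : (0 < n)%N by near: n; exact: nbhs_infty_gt.
apply/andP; split.
  (* The supremum is nonnegative because it is at least the distance at the point 0. *)
  by apply: ereal_sup_ge; eexists; [exists 0 => //|rewrite lee_fin].
apply: ge_ereal_sup => _ [x _ <-]; exact: normalized_density_dist.
Unshelve. all: by end_near. Qed.
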